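(* Let $\mathcal S$ be any collection of seed triples. For integers $d,k\ge1$ define \[ L_{\mathcal S}(d,k)=\max\left\{k-K+\prod_{j=1}^tM_j:\ t\ge0,\ (d_j,k_j,M_j)\in\mathcal S\ (1\le j\le t),\ \sum_{j=1}^td_j\le d,\ K=\prod_{j=1}^tk_j\le k\right\}, \] with empty products equal to $1$, empty sums equal to $0$, and inadmissible choices ignored. Then \[ m(d,k)\ge L_{\mathcal S}(d,k). \] Likewise, if $\mathcal S$ is a collection of homoscedastic seed triples, then $m_{\mathrm{hom}}(d,k)\ge L_{\mathcal S}(d,k)$.
   Context: A $k$-component Gaussian mixture density on $\mathbb{R}^d$ is a function $\Phi(x)=\sum_{i=1}^k\alpha_i\phi_i(x)$, where $\alpha_i>0$, $\sum_{i=1}^k\alpha_i=1$, and $\phi_i(x)=(2\pi)^{-d/2}\det(\Sigma_i)^{-1/2}\exp\left(-\frac12(x-\mu_i)^\top\Sigma_i^{-1}(x-\mu_i)\right)$ with $\mu_i\in\mathbb{R}^d$ and each $\Sigma_i$ a (symmetric) positive definite $d\times d$ matrix. It is homoscedastic if $\Sigma_1=\cdots=\Sigma_k$. The modal set $\mathrm{Mode}(\Phi)$ is the set of modes, i.e. of all (not necessarily strict) local maximum points of $\Phi$: $x\in\mathrm{Mode}(\Phi)$ iff there is $\rho>0$ with $\Phi(y)\le\Phi(x)$ whenever $\|y-x\|<\rho$. $m(d,k)$ denotes the supremum of $|\mathrm{Mode}(\Phi)|$ over all $k$-component Gaussian mixture densities $\Phi$ on $\mathbb{R}^d$ with finite modal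 set; $m_{\mathrm{hom}}(d,k)$ is the same supremum restricted to homoscedastic mixtures. A seed triple is a triple of positive integers $(d_0,k_0,M_0)$ for which there exists a $k_0$-component Gaussian mixture in $\mathbb{R}^{d_0}$ with finite modal set and at least $M_0$ modes. A homoscedastic seed triple is defined in the same way with the additional requirement that the mixture is homoscedastic. *)

(* Defs.v *)
From mathcomp Require Import all_boot all_order all_algebra.
From mathcomp Require Import finmap.
From mathcomp Require Import all_classical all_reals all_analysis.

Set Implicit Arguments.
Unset Strict Implicit.
Unset Printing Implicit Defensive.

Import Order.TTheory GRing.Theory Num.Theory.

Local Open Scope classical_set_scope.
Local Open Scope ring_scope.

(* The library norm on matrices is the sup norm, so the Euclidean one is
   spelled out. *)
Definition enorm (R : realType) (d : nat) (x : 'cV[R]_d) : R :=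
  Num.sqrt (\sum_(i < d) x i 0 ^+ 2).

Definition pos_def (R : realType) (d : nat) (A : 'M[R]_d) : Prop :=
  A^T = A /\ forall x : 'cV[R]_d, x != 0 -> 0 < (x^T *m A *m x) 0 0.

Definition gauss (R : realType) (d : nat) (mu : 'cV[R]_d) (Sigma : 'M[R]_d)
    (x : 'cV[R]_d) : R :=
  (2 * pi) `^ (- (d%:R / 2)) * (\det Sigma) `^ (- (1 / 2)) *
  expR (- (1 / 2) * ((x - mu)^T *m invmx Sigma *m (x - mu)) 0 0).

(* The components are not required to be pairwise distinct. *)
Record gauss_mixture (R : realType) (d k : nat) := GaussMixture {
  weight : 'I_k -> R ;
  mean : 'I_k -> 'cV[R]_d ;
  cov : 'I_k -> 'M[R]_d ;
  weight_gt0 : forall i, 0 < weight i ;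
  weight_sum1 : \sum_(i < k) weight i = 1 ;
  cov_pos_def : forall i, pos_def (cov i) }.

Definition density (R : realType) (d k : nat) (G : gauss_mixture R d k)
    (x : 'cV[R]_d) : R :=
  \sum_(i < k) weight G i * gauss (mean G i) (cov G i) x.

Definition homoscedastic (R : realType) (d k : nat)
    (G : gauss_mixture R d k) : Prop :=
  forall i j, cov G i = cov G j.

Definition Mode (R : realType) (d : nat) (Phi : 'cV[R]_d -> R) :
    set 'cV[R]_d :=
  [set x | exists2 rho : R, 0 < rho &
             forall y, enorm (y - x) < rho -> Phi y <= Phi x].

(* [fset_set] returns the empty set on infinite sets: the number below is only
   used together with [finite_set (Mode Phi)]. *)
Definition nb_modes (R : realType) (d : nat) (Phi : 'cV[R]_d -> R) : nat :=
  #|` fset_set (Mode Phi)|%fset.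

Definition max_modes (R : realType) (d k : nat) : \bar R :=
  ereal_sup [set x | exists G : gauss_mixture R d k,
    finite_set (Mode (density G)) /\ x = (nb_modes (density G))%:R%:E].

Definition max_modes_hom (R : realType) (d k : nat) : \bar R :=
  ereal_sup [set x | exists G : gauss_mixture R d k,
    [/\ homoscedastic G, finite_set (Mode (density G)) &
        x = (nb_modes (density G))%:R%:E]].

Record triple := Triple { tdim : nat ; tcomp : nat ; tmodes : nat }.

Definition seed_triple (R : realType) (p : triple) : Prop :=
  [/\ (0 < tdim p)%N, (0 < tcomp p)%N, (0 < tmodes p)%N &
      exists G : gauss_mixture R (tdim p) (tcomp p),
        finite_set (Mode (density G)) /\
        (tmodes p <= nb_modes (density G))%N].

Definition hom_seed_triple (R : realType) (p : triple) : Prop :=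
  [/\ (0 < tdim p)%N, (0 < tcomp p)%N, (0 < tmodes p)%N &
      exists G : gauss_mixture R (tdim p) (tcomp p),
        [/\ homoscedastic G, finite_set (Mode (density G)) &
            (tmodes p <= nb_modes (density G))%N]].

(* A choice of t triples, possibly with repetitions. *)
Definition admissible (S : set triple) (d k t : nat) (p : 'I_t -> triple) :
    Prop :=
  [/\ forall j, S (p j), (\sum_(j < t) tdim (p j) <= d)%N &
      (\prod_(j < t) tcomp (p j) <= k)%N].

(* The truncated subtraction is exact on admissible choices. *)
Definition choice_value (k t : nat) (p : 'I_t -> triple) : nat :=
  (k - \prod_(j < t) tcomp (p j) + \prod_(j < t) tmodes (p j))%N.

(* The maximum is taken as a supremum in the extended reals, so that no a
   priori bound on the values is presupposed; [seed_bound_max] and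
   [seed_bound_ub] show that it is the maximum whenever there is one. *)
Definition seed_bound (R : realType) (S : set triple) (d k : nat) : \bar R :=
  ereal_sup [set x | exists (t : nat) (p : 'I_t -> triple),
    admissible S d k p /\ x = (choice_value k p)%:R%:E].

Lemma seed_bound_ub (R : realType) (S : set triple) (d k t : nat)
    (p : 'I_t -> triple) :
  admissible S d k p -> ((choice_value k p)%:R%:E <= seed_bound R S d k)%E.
Proof. by move=> pS; apply: ereal_sup_ubound; exists t, p. Qed.

Lemma seed_bound_max (R : realType) (S : set triple) (d k t : nat)
    (p : 'I_t -> triple) :
  admissible S d k p ->
  (forall (u : nat) (q : 'I_u -> triple),
     admissible S d k q -> (choice_value k q <= choice_value k p)%N) ->
  seed_bound R S d k = (choice_value k p)%:R%:E.
Proof.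
move=> pS pmax; apply/eqP; rewrite eq_le seed_bound_ub // andbT.
apply: ge_ereal_sup => _ [u [q [qS ->]]].
by rewrite lee_fin ler_nat pmax.
Qed.

(* Main.v *)
Require Import Defs.
From mathcomp Require Import all_boot all_order all_algebra finmap.
From mathcomp Require Import all_classical all_reals all_analysis.
From mathcomp Require Import ring lra zify.

Set Implicit Arguments.
Unset Strict Implicit.
Unset Printing Implicit Defensive.

Import Order.TTheory GRing.Theory Num.Theory.
Import numFieldNormedType.Exports.

Local Open Scope classical_set_scope.
Local Open Scope ring_scope.

(** Two constructions carry the proof.

    Products.  The tensor product of two mixtures is a mixture, with
    block-diagonal covariances, and, densities being positive, its modes are
    the pairs of modes of the factors ([Mode_tensor]).  A choice of seeds thus
    gives [K] components and the product of the [M_j] as number of modes, and a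
    factor with a single component pads the dimension up to [d].

    Adding a component ([realizable_add]).  It remains to gain one mode for
    each of the [k - K] missing components.  When the modes are finite in
    number they are strict local maxima, so they survive every small
    perturbation ([peaks_stable]); a small bump placed far away, where the
    density is negligible, creates one more ([peaks_add_bump]).  The number of
    modes might have become infinite, and genericity has to be restored inside
    the class of mixtures.  The right move is to multiply the density [f] by
    [exp <a, x>]: this only shifts the means and rescales the weights
    ([tilt_gsum]), while it turns [ln f] into [ln f + <a, x>].  The critical
    points are then the solutions of [grad (ln f) = - a], they stay in a ball
    that does not depend on [a] ([tilt_modes_bounded]), and for arbitrarily
    small [a] they are finite in number ([generic_fibre_finite]).  The last
    fact is a Sard theorem for gradient fields.  It is proved here at one fixed
    scale by counting: cut the ball into small cells; if a cell contains two
    points with the same gradient, then the symmetry of the Hessian squeezes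
    the image of the whole cell into a slab whose thickness is quadratic in the
    size of the cell ([fibre_squeeze]), and there are too few cells for these
    slabs to cover a fine grid of values.

    The new bump borrows the covariance of an existing component and tilting
    preserves the covariances, as a product preserves their equality: the
    homoscedastic case is the same proof, and a boolean selects it. *)

(** * Finite families, sup norm and compactness for column vectors *)

(** The smallest of finitely many admissible values; this replaces explicit
    minima over finite families of points, matrices and modes. *)
Lemma common_eps (R : realType) (T : eqType) (s : seq T) (P : T -> R -> Prop) :
  (forall x e e', 0 < e' -> e' <= e -> P x e -> P x e') ->
  (forall x, x \in s -> exists2 e, 0 < e & P x e) ->
  exists2 e, 0 < e & forall x, x \in s -> P x e.
Proof.
move=> mono; elim: s => [|y s IH] sP; first by exists 1.
have [|e e0 eP] := IH; first by move=> x xs; apply: sP; rewrite inE xs orbT.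
have [|e' e'0 yP] := sP y; first by rewrite inE eqxx.
have m0 : 0 < Num.min e e' by rewrite lt_min e0 e'0.
exists (Num.min e e') => // x; rewrite inE => /predU1P[->|xs].
  by apply: mono yP => //; rewrite ge_min lexx orbT.
by apply: mono (eP x xs) => //; rewrite ge_min lexx.
Qed.

Lemma entry_le (R : realType) m n (A : 'M[R]_(m, n)) i j : `|A i j| <= `|A|.
Proof.
rewrite [leRHS]/Num.norm /= mx_normrE.
by apply/bigmax_geP; right => /=; exists (i, j).
Qed.

Section Norm.
Variables (R : realType) (d : nat).
Implicit Types (x y z u v w : 'cV[R]_d) (A : 'M[R]_d).

Lemma coord_le x i : `|x i 0| <= `|x|.
Proof. exact: entry_le. Qed.

Lemma norm_le x c : 0 <= c -> (forall i, `|x i 0| <= c) -> `|x| <= c.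
Proof.
move=> c0 xc; rewrite [leLHS]/Num.norm /= mx_normrE.
by apply/bigmax_leP; split => // -[i j] _ /=; rewrite ord1.
Qed.

Lemma norm_lt x c : 0 < c -> (forall i, `|x i 0| < c) -> `|x| < c.
Proof.
move=> c0 xc; rewrite [ltLHS]/Num.norm /= mx_normrE.
by apply/bigmax_ltP; split => // -[i j] _ /=; rewrite ord1.
Qed.

Lemma norm_attained x : x != 0 -> exists i, `|x i 0| = `|x|.
Proof.
move=> x0; have : mx_norm x != 0 by rewrite -[mx_norm x]/`|x| normr_eq0.
by move=> /mx_norm_neq0[[i j] /= xij]; exists i; rewrite [j]ord1 in xij.
Qed.

Definition dot u v : R := \sum_i u i 0 * v i 0.

Lemma dotE u v : (u^T *m v) 0 0 = dot u v.
Proof. by rewrite mxE; apply: eq_bigr => i _; rewrite mxE. Qed.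

Lemma dotC u v : dot u v = dot v u.
Proof. by apply: eq_bigr => i _; rewrite mulrC. Qed.

Lemma dotDl u v w : dot (u + v) w = dot u w + dot v w.
Proof. by rewrite -big_split; apply: eq_bigr => i _; rewrite mxE mulrDl. Qed.

Lemma dotZl a u w : dot (a *: u) w = a * dot u w.
Proof. by rewrite mulr_sumr; apply: eq_bigr => i _; rewrite mxE mulrA. Qed.

Lemma dotDr u v w : dot w (u + v) = dot w u + dot w v.
Proof. by rewrite dotC dotDl !(dotC _ w). Qed.

Lemma dotZr a u w : dot w (a *: u) = a * dot w u.
Proof. by rewrite dotC dotZl (dotC _ w). Qed.

Lemma dotNl u w : dot (- u) w = - dot u w.
Proof. by rewrite -scaleN1r dotZl mulN1r. Qed.

Lemma dotNr u w : dot w (- u) = - dot w u.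
Proof. by rewrite dotC dotNl (dotC _ w). Qed.

Lemma dot0l w : dot 0 w = 0.
Proof. by rewrite -(scale0r 0) dotZl mul0r. Qed.

Lemma dot_suml (I : finType) (F : I -> 'cV[R]_d) w :
  dot (\sum_i F i) w = \sum_i dot (F i) w.
Proof.
apply: (big_morph (dot^~ w)) => [u v|]; last exact: dot0l.
exact: dotDl.
Qed.

Lemma dot_mulmx A u v : dot u (A *m v) = dot (A^T *m u) v.
Proof. by rewrite -!dotE trmx_mul trmxK mulmxA. Qed.

Lemma dot_sym A u v : A^T = A -> dot u (A *m v) = dot v (A *m u).
Proof. by move=> As; rewrite dot_mulmx As dotC. Qed.

Lemma dot_ge0 u : 0 <= dot u u.
Proof. by apply: sumr_ge0 => i _; rewrite -expr2 sqr_ge0. Qed.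

Lemma dot_eq0 u : dot u u = 0 -> u = 0.
Proof.
move=> /eqP; rewrite psumr_eq0 => [/allP u0|i _]; last by rewrite -expr2 sqr_ge0.
apply/colP => i; rewrite mxE; have /= := u0 i (mem_index_enum i).
by rewrite mulf_eq0 orbb => /eqP.
Qed.

Lemma dot_le u v : `|dot u v| <= d%:R * `|u| * `|v|.
Proof.
apply: le_trans (ler_norm_sum _ _ _) _.
apply: (@le_trans _ _ (\sum_(i < d) `|u| * `|v|)).
  by apply: ler_sum => i _; rewrite normrM ler_pM ?coord_le.
by rewrite sumr_const card_ord -mulrA [leRHS]mulr_natl.
Qed.

Lemma mulmx_le A x : `|A *m x| <= d%:R * `|A| * `|x|.
Proof.
apply: norm_le => [|i]; first by rewrite !mulr_ge0.
rewrite mxE; apply: le_trans (ler_norm_sum _ _ _) _.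
apply: (@le_trans _ _ (\sum_(i < d) `|A| * `|x|)).
  by apply: ler_sum => j _; rewrite normrM ler_pM ?entry_le.
by rewrite sumr_const card_ord -mulrA [leRHS]mulr_natl.
Qed.

Lemma enorm_ge x : `|x| <= enorm x.
Proof.
apply: norm_le => [|i]; first exact: sqrtr_ge0.
rewrite -sqrtr_sqr ler_wsqrtr // (bigD1 i) //= lerDl.
by apply: sumr_ge0 => j _; rewrite sqr_ge0.
Qed.

Lemma enorm_le x : enorm x <= d%:R * `|x|.
Proof.
rewrite -(ger0_norm (_ : 0 <= d%:R * `|x|)) ?mulr_ge0 // -sqrtr_sqr ler_wsqrtr //.
apply: (@le_trans _ _ (\sum_(i < d) `|x| ^+ 2)).
  apply: ler_sum => i _; rewrite -[leLHS]real_normK ?num_real //.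
  by rewrite lerXn2r ?nnegrE ?coord_le.
rewrite sumr_const card_ord exprMn -[leLHS]mulr_natl ler_wpM2r ?sqr_ge0 //.
by rewrite -natrX ler_nat; case: (d) => // n; rewrite leq_pmulr.
Qed.

(** Local maxima do not depend on the norm, and the sup norm fits the boxes,
    grids and block vectors used below. *)
Lemma ModeP (f : 'cV[R]_d -> R) x :
  Mode f x <-> exists2 r, 0 < r & forall y, `|y - x| < r -> f y <= f x.
Proof.
split=> -[r r0 fr].
  have d0 : 0 < d%:R + 1 :> R by rewrite ltr_wpDl.
  exists (r / (d%:R + 1)) => [|y yx]; first by rewrite divr_gt0.
  apply: fr; rewrite ltr_pdivlMr // in yx.
  apply: le_lt_trans (enorm_le _) (le_lt_trans _ yx).
  by rewrite mulrC ler_wpM2l // lerDl.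
by exists r => // y yx; apply: fr; apply: le_lt_trans (enorm_ge _) yx.
Qed.

Lemma cV_bounded_closed_compact (A : set 'cV[R]_d) :
  bounded_set A -> closed A -> compact A.
Proof.
have trmx_norm (u : 'rV[R]_d) : `|u^T| <= `|u|.
  by apply: norm_le => // i; rewrite mxE entry_le.
have trmx_norm' (x : 'cV[R]_d) : `|x^T| <= `|x|.
  rewrite [leLHS]/Num.norm /= mx_normrE; apply/bigmax_leP; split => // -[j i] _ /=.
  by rewrite mxE ord1 coord_le.
have trmx_cont : continuous (fun u : 'rV[R]_d => u^T : 'cV[R]_d).
  move=> u; apply/(@cvgrPdist_lt _ _ _ _ (nbhs_filter u)) => e e0.
  apply: filterS (nbhsx_ballx u e e0) => v; rewrite -ball_normE /= => uv.
  by rewrite -linearB /=; apply: le_lt_trans (trmx_norm _) uv.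
move=> Ab Ac; pose tr (u : 'rV[R]_d) : 'cV[R]_d := u^T.
have -> : A = tr @` (tr @^-1` A).
  apply/seteqP; split=> x /=.
    by exists x^T; rewrite /tr /= trmxK.
  by move=> [u ? <-].
apply: continuous_compact; first exact: continuous_subspaceT.
apply: bounded_closed_compact.
  case: Ab => M [Mr AM]; exists M; split=> // r /AM {}AM u /AM /= ur.
  by apply: le_trans ur; rewrite -{1}(trmxK u) trmx_norm'.
by apply: preimage_closed => //; move=> u _ ; exact: trmx_cont.
Qed.

Lemma lip_continuous (f : 'cV[R]_d -> R) :
  (forall r, exists C, forall x z, `|x| <= r -> `|z| <= r ->
     `|f z - f x| <= C * `|z - x|) -> continuous f.
Proof.
move=> fl x; apply/(@cvgrPdist_lt _ _ _ _ (nbhs_filter x)) => e e0.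
have [C fC] := fl (`|x| + 1).
have C1 : 0 < `|C| + 1 by rewrite ltr_wpDl.
have r0 : 0 < Num.min 1 (e / (`|C| + 1)) by rewrite lt_min ltr01 divr_gt0.
apply: filterS (nbhsx_ballx x _ r0) => z; rewrite -ball_normE /= distrC lt_min.
move=> /andP[zx1 zxe]; rewrite distrC; apply: (@le_lt_trans _ _ (C * `|z - x|)).
  apply: fC; first by rewrite lerDl.
  by rewrite -(subrK x z) addrC (le_trans (ler_normD _ _)) // lerD2l ltW.
rewrite ltr_pdivlMr // in zxe; apply: le_lt_trans zxe.
by rewrite mulrC ler_wpM2l // (le_trans (ler_norm _)) // lerDl.
Qed.

Lemma dist_continuous x : continuous (fun y => `|y - x|).
Proof.
apply: lip_continuous => r; exists 1 => y z _ _; rewrite mul1r.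
by rewrite (le_trans (ler_dist_dist _ _)) // opprB addrA subrK.
Qed.

Lemma sphere_compact x (r : R) : compact [set y | `|y - x| = r].
Proof.
apply: cV_bounded_closed_compact.
  exists (`|x| + r); split; first exact: num_real.
  move=> M rM y /= yx; apply: le_trans (ltW rM).
  by rewrite -(subrK x y) addrC (le_trans (ler_normD _ _)) // yx.
have -> : [set y | `|y - x| = r] = (fun y => `|y - x|) @^-1` [set r].
  by [].
apply: preimage_closed; last exact: closed_eq.
by move=> y _; exact: dist_continuous.
Qed.

Lemma closed_ball_compact x (r : R) : compact [set y | `|y - x| <= r].
Proof.
apply: cV_bounded_closed_compact.
  exists (`|x| + r); split; first exact: num_real.
  move=> M rM y /= yx; apply: le_trans (ltW rM).
  rewrite -(subrK x y) addrC; apply: le_trans (ler_normD _ _) _.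
  by rewrite lerD2l.
have -> : [set y | `|y - x| <= r] = (fun y => `|y - x|) @^-1` [set t | t <= r].
  by [].
apply: preimage_closed; last exact: closed_le.
by move=> y _; exact: dist_continuous.
Qed.

Lemma compact_max (f : 'cV[R]_d -> R) (A : set 'cV[R]_d) :
  compact A -> A !=set0 -> continuous f ->
  exists2 c, A c & forall y, A y -> f y <= f c.
Proof.
move=> cA A0 cf; have [|c cA' fc] := @compact_EVT_max _ _ f A A0 cA.
  exact: continuous_subspaceT.
by exists c => [|y Ay]; [exact: set_mem|apply: fc; exact: mem_set].
Qed.

End Norm.
(** * Functions with a locally uniform first-order expansion *)

Section Smooth.
Variables (R : realType) (d : nat).
Implicit Types (phi psi : 'cV[R]_d -> R) (g h : 'cV[R]_d -> 'cV[R]_d).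

(** First-order expansion with a quadratic remainder, uniformly on bounded
    sets: this is all that the counting argument asks of a gradient
    field, and it passes to sums, products and composites by elementary
    estimates. *)
Definition smooth phi g := forall r, exists2 C, 0 <= C &
  forall x z, `|x| <= r -> `|z| <= r ->
  [/\ `|phi x| <= C, `|g x| <= C &
      `|phi z - phi x - dot (g x) (z - x)| <= C * `|z - x| ^+ 2].

Lemma smooth_intro phi g :
  (forall r, exists a b c, forall x z, `|x| <= r -> `|z| <= r ->
    [/\ `|phi x| <= a, `|g x| <= b &
        `|phi z - phi x - dot (g x) (z - x)| <= c * `|z - x| ^+ 2]) ->
  smooth phi g.
Proof.
move=> pg r; have [a [b [c abc]]] := pg r.
exists (`|a| + `|b| + `|c|); first by rewrite !addr_ge0.
move=> x z xr zr; have [xa xb xc] := abc x z xr zr.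
have := ler_norm a; have := ler_norm b; have := ler_norm c.
have := normr_ge0 a; have := normr_ge0 b; have := normr_ge0 c.
move=> a0 b0 c0 la lb lc; split; [lra|lra|apply: le_trans xc _].
by apply: ler_wpM2r; [exact: sqr_ge0|lra].
Qed.

Lemma smooth_ext phi psi g h :
  phi =1 psi -> g =1 h -> smooth phi g -> smooth psi h.
Proof. by move=> /funext <- /funext <-. Qed.

(** On the ball of radius [r] one has [|z - x| <= 2 r], so the quadratic
    remainder is also linear. *)
Lemma smooth_lip phi g : smooth phi g ->
  forall r, exists2 C, 0 <= C & forall x z, `|x| <= r -> `|z| <= r ->
     `|phi z - phi x| <= C * `|z - x|.
Proof.
move=> pg r; have [C C0 Cxz] := pg r.
exists (C * d%:R + C * (`|r| + `|r|)) => [|x z xr zr].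
  by rewrite addr_ge0 ?mulr_ge0 ?addr_ge0.
have [_ gx Ez] := Cxz x z xr zr.
rewrite -(subrK (dot (g x) (z - x)) (phi z - phi x)).
apply: le_trans (ler_normD _ _) _; rewrite addrC mulrDl lerD //.
  apply: le_trans (dot_le _ _) _; rewrite ler_wpM2r // mulrC.
  by rewrite ler_wpM2r.
apply: le_trans Ez _; rewrite expr2 mulrA ler_wpM2r // ler_wpM2l //.
apply: le_trans (ler_normB _ _) _.
by apply: lerD; [apply: le_trans zr _|apply: le_trans xr _]; exact: ler_norm.
Qed.

Lemma smooth_continuous phi g : smooth phi g -> continuous phi.
Proof.
move=> pg; apply: lip_continuous => r; have [C _ Cxz] := smooth_lip pg r.
by exists C.
Qed.

Lemma smooth_cst c : smooth (fun=> c) (fun=> 0).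
Proof.
apply: smooth_intro => r; exists `|c|, 0, 0 => x z _ _; split=> //.
  by rewrite normr0.
by rewrite dot0l !subrr normr0 mul0r.
Qed.

Lemma smoothD phi psi g h : smooth phi g -> smooth psi h ->
  smooth (fun x => phi x + psi x) (fun x => g x + h x).
Proof.
move=> pg ph; apply: smooth_intro => r; have [C C0 Cx] := pg r.
have [D D0 Dx] := ph r; exists (C + D), (C + D), (C + D) => x z xr zr.
have [C1 C2 C3] := Cx x z xr zr; have [D1 D2 D3] := Dx x z xr zr.
split; [exact: le_trans (ler_normD _ _) (lerD _ _)..|].
have -> : phi z + psi z - (phi x + psi x) - dot (g x + h x) (z - x) =
    (phi z - phi x - dot (g x) (z - x)) + (psi z - psi x - dot (h x) (z - x)).
  by rewrite dotDl; ring.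
by rewrite mulrDl; apply: le_trans (ler_normD _ _) (lerD C3 D3).
Qed.

Lemma smooth_sum (I : finType) (phi : I -> 'cV[R]_d -> R)
    (g : I -> 'cV[R]_d -> 'cV[R]_d) : (forall i, smooth (phi i) (g i)) ->
  smooth (fun x => \sum_i phi i x) (fun x => \sum_i g i x).
Proof.
move=> pg; elim: (index_enum I) => [|i s IH].
  by apply: smooth_ext (smooth_cst 0) => x; rewrite big_nil.
by apply: smooth_ext (smoothD (pg i) IH) => x; rewrite big_cons.
Qed.

Lemma smoothM phi psi g h : smooth phi g -> smooth psi h ->
  smooth (fun x => phi x * psi x) (fun x => phi x *: h x + psi x *: g x).
Proof.
move=> pg ph; apply: smooth_intro => r; have [C C0 Cx] := pg r.
have [D D0 Dx] := ph r; have [L L0 Lx] := smooth_lip pg r.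
have [M M0 Mx] := smooth_lip ph r.
exists (C * D), (C * D + D * C), (C * D + D * C + L * M) => x z xr zr.
have [C1 C2 C3] := Cx x z xr zr; have [D1 D2 D3] := Dx x z xr zr.
split.
- by rewrite normrM ler_pM.
- apply: le_trans (ler_normD _ _) _.
  by rewrite !mx_normZ lerD // ler_pM.
have -> : phi z * psi z - phi x * psi x -
    dot (phi x *: h x + psi x *: g x) (z - x) =
  phi x * (psi z - psi x - dot (h x) (z - x)) +
  psi x * (phi z - phi x - dot (g x) (z - x)) +
  (phi z - phi x) * (psi z - psi x) by rewrite dotDl !dotZl; ring.
apply: le_trans (ler_normD _ _) _; rewrite [leRHS]mulrDl lerD //.
  apply: le_trans (ler_normD _ _) _; rewrite [leRHS]mulrDl -!mulrA !normrM.
  by rewrite lerD // ler_pM.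
by rewrite expr2 mulrACA normrM ler_pM // ?Lx ?Mx.
Qed.

Lemma smooth_comp (t t' : R -> R) phi g : smooth phi g ->
  (forall r, exists C, forall x z, `|x| <= r -> `|z| <= r ->
    [/\ `|t (phi x)| <= C, `|t' (phi x)| <= C &
     `|t (phi z) - t (phi x) - t' (phi x) * (phi z - phi x)|
       <= C * (phi z - phi x) ^+ 2]) ->
  smooth (fun x => t (phi x)) (fun x => t' (phi x) *: g x).
Proof.
move=> pg tp; apply: smooth_intro => r; have [C C0 Cx] := pg r.
have [L L0 Lx] := smooth_lip pg r; have [D Dx] := tp r.
exists D, (D * C), (D * L ^+ 2 + D * C) => x z xr zr.
have [C1 C2 C3] := Cx x z xr zr; have [D1 D2 D3] := Dx x z xr zr.
have D0 : 0 <= D := le_trans (normr_ge0 _) D1.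
split; [by []|by rewrite mx_normZ ler_pM|].
have -> : t (phi z) - t (phi x) - dot (t' (phi x) *: g x) (z - x) =
  (t (phi z) - t (phi x) - t' (phi x) * (phi z - phi x)) +
  t' (phi x) * (phi z - phi x - dot (g x) (z - x)) by rewrite dotZl; ring.
apply: le_trans (ler_normD _ _) _; rewrite [leRHS]mulrDl lerD //.
  apply: le_trans D3 _; rewrite -mulrA ler_wpM2l // -exprMn.
  by rewrite -[leLHS]real_normK ?num_real // lerXn2r ?nnegrE ?mulr_ge0 // Lx.
by rewrite normrM -mulrA ler_pM.
Qed.

Lemma expR_quad (M s u : R) : s <= M -> u <= M ->
  `|expR u - expR s - expR s * (u - s)| <= 2 * expR M * (u - s) ^+ 2.
Proof.
move=> sM uM; have es : expR s <= expR M by rewrite ler_expR.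
have eu : expR u <= expR M by rewrite ler_expR.
have s0 := expR_ge0 s; have u0 := expR_ge0 u.
have h1 : expR s * (1 + (u - s)) <= expR u.
  rewrite -[in leRHS](subrK s u) expRD mulrC ler_wpM2r //; exact: expR_ge1Dx.
have h2 : expR u * (1 + (s - u)) <= expR s.
  rewrite -[in leRHS](subrK u s) expRD mulrC ler_wpM2r //; exact: expR_ge1Dx.
rewrite ger0_norm; last by lra.
have q0 := sqr_ge0 (u - s).
suff : expR u - expR s - expR s * (u - s) <= (expR u + expR s) * (u - s) ^+ 2.
  by have := ler_wpM2r q0 (lerD eu es); lra.
have [us|us] := leP 0 (u - s).
  by have := ler_wpM2l us h2; have := mulr_ge0 s0 q0; rewrite !expr2; lra.
by have := ler_wnM2l (ltW us) h1; have := mulr_ge0 u0 q0; rewrite !expr2; lra.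
Qed.

End Smooth.
Section SmoothExamples.
Variables (R : realType) (d : nat).
Implicit Types (phi : 'cV[R]_d -> R) (g : 'cV[R]_d -> 'cV[R]_d).

Lemma smooth_expR phi g : smooth phi g ->
  smooth (fun x => expR (phi x)) (fun x => expR (phi x) *: g x).
Proof.
move=> pg; apply: (smooth_comp (t := expR) (t' := expR)) => // r.
have [C C0 Cx] := pg r; exists (2 * expR C) => x z xr zr.
have [/ler_normlP[_ xC] _ _] := Cx x z xr zr.
have [/ler_normlP[_ zC] _ _] := Cx z x zr xr.
have e0 := expR_gt0 C; have := expR_gt0 (phi x) => x0.
have : expR (phi x) <= expR C by rewrite ler_expR.
by move=> le; rewrite (ger0_norm (ltW x0)); split; [lra|lra|exact: expR_quad].
Qed.

Lemma smooth_inv phi g : smooth phi g ->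
  (forall r, exists2 m, 0 < m & forall x, `|x| <= r -> m <= phi x) ->
  smooth (fun x => (phi x)^-1) (fun x => - (phi x)^-2 *: g x).
Proof.
move=> pg pm.
apply: (smooth_comp (t := fun s => s^-1) (t' := fun s => - s ^- 2)) => // r.
have [m m0 mx] := pm r; exists (m^-1 + m^-1 ^+ 2 + m^-1 ^+ 3) => x z xr zr.
have [xm zm] := (mx x xr, mx z zr).
have [x0 z0] := (lt_le_trans m0 xm, lt_le_trans m0 zm).
have xm' : (phi x)^-1 <= m^-1 by rewrite lef_pV2 ?posrE.
have zm' : (phi z)^-1 <= m^-1 by rewrite lef_pV2 ?posrE.
have xi : 0 < (phi x)^-1 by rewrite invr_gt0.
have zi : 0 < (phi z)^-1 by rewrite invr_gt0.
have mi : 0 < m^-1 by rewrite invr_gt0.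
have x2 : (phi x)^-1 ^+ 2 <= m^-1 ^+ 2 by rewrite lerXn2r ?nnegrE // ltW.
have m3 : 0 <= m^-1 ^+ 3 by rewrite exprn_ge0 // ltW.
have m2 := sqr_ge0 (phi x)^-1; split.
- by rewrite (ger0_norm (ltW xi)); lra.
- by rewrite normrN -exprVn (ger0_norm m2); lra.
have -> : (phi z)^-1 - (phi x)^-1 - - phi x ^- 2 * (phi z - phi x) =
  (phi z)^-1 * (phi x)^-1 ^+ 2 * (phi z - phi x) ^+ 2.
  by field; rewrite !gt_eqF.
rewrite ger0_norm; last exact: mulr_ge0 (mulr_ge0 (ltW zi) m2) (sqr_ge0 _).
apply: ler_wpM2r; first exact: sqr_ge0.
have : (phi z)^-1 * (phi x)^-1 ^+ 2 <= m^-1 * m^-1 ^+ 2 by rewrite ler_pM // ltW.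
rewrite -exprS; lra.
Qed.

Lemma smooth_affine (b : 'cV[R]_d) (c : R) :
  smooth (fun x => dot b x + c) (fun=> b).
Proof.
apply: smooth_intro => r; exists (d%:R * `|b| * `|r| + `|c|), `|b|, 0 => x z xr _.
split=> //.
  apply: le_trans (ler_normD _ _) _; rewrite lerD2r.
  apply: le_trans (dot_le _ _) _; apply: ler_wpM2l; first by rewrite mulr_ge0.
  exact: le_trans xr (ler_norm _).
rewrite (_ : _ - _ = 0) ?normr0 ?mul0r //.
by rewrite dotDr dotNr; ring.
Qed.

Lemma smooth_quadratic (A : 'M[R]_d) (mu : 'cV[R]_d) : A^T = A ->
  smooth (fun x => - (1 / 2) * dot (x - mu) (A *m (x - mu)))
         (fun x => A *m (mu - x)).
Proof.
move=> As; apply: smooth_intro => r.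
pose s := `|r| + `|mu|; pose K := d%:R * `|A|.
exists (d%:R * s * (K * s)), (K * s), (d%:R * K) => x z xr zr.
have K0 : 0 <= K by rewrite mulr_ge0.
have xs : `|x - mu| <= s.
  apply: le_trans (ler_normB _ _) _; rewrite lerD2r.
  exact: le_trans xr (ler_norm _).
have s0 : 0 <= s := le_trans (normr_ge0 _) xs.
have half (t u : R) : `|t| <= u -> `|- (1 / 2) * t| <= u.
  move=> tu; rewrite normrM normrN (ger0_norm (_ : 0 <= 1 / 2)) ?divr_ge0 //.
  by have := le_trans (normr_ge0 _) tu; lra.
have Ax : `|A *m (x - mu)| <= K * s.
  by apply: le_trans (mulmx_le _ _) _; rewrite ler_wpM2l.
split.
- apply: half; apply: le_trans (dot_le _ _) _.
  by apply: ler_pM => //; rewrite ?mulr_ge0 // ler_wpM2l.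
- by rewrite -opprB mulmxN normrN.
have -> : - (1 / 2) * dot (z - mu) (A *m (z - mu)) -
    - (1 / 2) * dot (x - mu) (A *m (x - mu)) - dot (A *m (mu - x)) (z - x) =
    - (1 / 2) * dot (z - x) (A *m (z - x)).
  have -> : z - mu = (z - x) + (x - mu) by rewrite addrA subrK.
  rewrite -(opprB x mu); move: (z - x) (x - mu) => h y.
  rewrite mulmxN dotNl mulmxDr !dotDl !dotDr.
  by rewrite (dot_sym y h As) (dotC (A *m y)); field.
apply: half; apply: le_trans (dot_le _ _) _.
rewrite expr2 -!mulrA; apply: ler_wpM2l => //.
have -> : d%:R * (`|A| * (`|z - x| * `|z - x|)) =
  `|z - x| * (d%:R * `|A| * `|z - x|) by ring.
by apply: ler_wpM2l => //; exact: mulmx_le.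
Qed.

End SmoothExamples.
(** * Finiteness of the generic fibres of a gradient field *)

Section Counting.

Lemma modn_inj_near (K a b : nat) :
  (a <= b + K)%N -> (b <= a + K)%N -> a = b %[mod K.+1] -> a = b.
Proof.
wlog ab : a b / (a <= b)%N => [hw aK bK mab|].
  have [ab|ba] := leqP a b; first exact: hw.
  by apply/esym; apply: hw => //; exact: ltnW.
move=> _ bK /esym/eqP; rewrite eqn_mod_dvd // => dv.
have [b_a|ba] := leqP (b - a) 0; first by lia.
by have := dvdn_leq ba dv; lia.
Qed.

(** A set of grid points that is thin in the direction [i]: its diameter is at
    most [K], and the other coordinates determine the [i]-th one up to an error
    [c].  Reducing the coordinates modulo [K.+1] and [c.+1] is then injective. *)
Lemma card_thin (n P K c : nat) (i : 'I_n.+1)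
    (B : {set {ffun 'I_n.+1 -> 'I_P}}) :
  (forall m m' j, m \in B -> m' \in B -> (m j <= m' j + K)%N) ->
  (forall m m', m \in B -> m' \in B -> (forall j, j != i -> m j = m' j) ->
     (m i <= m' i + c)%N) ->
  (#|B| <= K.+1 ^ n * c.+1)%N.
Proof.
move=> BK Bc.
pose f (m : {ffun 'I_n.+1 -> 'I_P}) : {ffun 'I_n -> 'I_K.+1} * 'I_c.+1 :=
  ([ffun j => inord (m (lift i j) %% K.+1)], inord (m i %% c.+1)).
have finj : {in B &, injective f}.
  move=> m m' mB mB' [/ffunP fj fi].
  have off j : j != i -> m j = m' j.
    rewrite eq_sym => /unlift_some[k -> _]; apply/val_inj; apply: (@modn_inj_near K).
    - exact: BK.
    - exact: BK.
    by have := congr1 val (fj k); rewrite /= !ffunE !inordK ?ltn_pmod //.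
  apply/ffunP => j; have [->|ji] := eqVneq j i; last exact: off.
  apply/val_inj; apply: (@modn_inj_near c).
  - exact: Bc.
  - by apply: Bc => // k ki; rewrite off.
  by have := congr1 val fi; rewrite /= !inordK ?ltn_pmod //.
rewrite -(card_in_imset finj); apply: leq_trans (max_card _) _.
by rewrite card_prod card_ffun !card_ord.
Qed.

Lemma card_bigcup_le (I T : finType) (F : I -> {set T}) :
  (#|(\bigcup_i F i)%SET| <= \sum_i #|F i|)%N.
Proof.
apply: (big_ind2 (fun (A : {set T}) k => (#|A| <= k)%N)) => //.
  by rewrite cards0.
move=> A k B l Ak Bl; apply: leq_trans (leq_card_setU _ _) _.
exact: leq_add.
Qed.

(** There are [N.+1 ^ n.+1] cells, each of which spoils at most [(a * N).+1 ^
    n * b.+1] grid values: the total is of order [N ^ (2 * n + 1)], one power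
    of [N] short of the [N ^ (2 * n + 2)] values available. *)
Lemma grid_count (n a b : nat) : exists2 N, (0 < N)%N &
  (N.+1 ^ n.+1 * ((a * N).+1 ^ n * b.+1) < (N ^ 2) ^ n.+1)%N.
Proof.
pose M := (2 ^ n.+1 * (a.+1 ^ n * b.+1))%N; exists M.+1 => //.
set N := M.+1.
apply: (@leq_ltn_trans ((2 * N) ^ n.+1 * ((a.+1 * N) ^ n * b.+1))%N).
  apply: leq_mul; first by rewrite leq_exp2r //; lia.
  rewrite leq_mul2r /=; case: (n) => [//|p]; rewrite leq_exp2r //; lia.
rewrite -expnM !expnMn.
have -> : (N ^ (2 * n.+1) = N * (N ^ n.+1 * N ^ n))%N.
  by rewrite -expnD -expnS; congr (N ^ _)%N; lia.
have -> : (2 ^ n.+1 * N ^ n.+1 * (a.+1 ^ n * N ^ n * b.+1) =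
  M * (N ^ n.+1 * N ^ n))%N by rewrite /M; ring.
by rewrite ltn_pmul2r // muln_gt0 !expn_gt0.
Qed.

End Counting.
Section GenericFibre.
Variables (R : realType) (n : nat).
Notation V := 'cV[R]_n.+1.
Variables (G : V -> V) (H : V -> 'M[R]_n.+1).
Hypothesis smoothG :
  forall j, smooth (fun x => G x j 0) (fun x => (row j (H x))^T).
Hypothesis symH : forall x, (H x)^T = H x.

Lemma field_expansion r : exists2 C, 0 <= C &
  forall x z, `|x| <= r -> `|z| <= r ->
  `|G z - G x| <= C * `|z - x| /\
  `|G z - G x - H x *m (z - x)| <= C * `|z - x| ^+ 2.
Proof.
have /choice[L Lx] : forall j, exists L, 0 <= L /\
    forall x z, `|x| <= r -> `|z| <= r ->
    `|G z j 0 - G x j 0| <= L * `|z - x|.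
  by move=> j; have [L L0 Lx] := smooth_lip (smoothG j) r; exists L.
have /choice[C Cx] : forall j, exists C, 0 <= C /\
    forall x z, `|x| <= r -> `|z| <= r ->
    `|G z j 0 - G x j 0 - dot (row j (H x))^T (z - x)| <= C * `|z - x| ^+ 2.
  move=> j; have [C C0 Cx] := smoothG j r; exists C; split=> // x z xr zr.
  by have [] := Cx x z xr zr.
have L0 j := (Lx j).1; have C0 j := (Cx j).1.
have LC0 : 0 <= \sum_j L j + \sum_j C j.
  by rewrite addr_ge0 // sumr_ge0.
have Lle j : L j <= \sum_j L j + \sum_j C j.
  rewrite (bigD1 j) //= -addrA lerDl addr_ge0 ?sumr_ge0 //.
have Cle j : C j <= \sum_j L j + \sum_j C j.
  rewrite addrC (bigD1 j) //= -addrA lerDl addr_ge0 ?sumr_ge0 //.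
exists (\sum_j L j + \sum_j C j) => // x z xr zr; split.
  apply: norm_le => [|j]; first by rewrite mulr_ge0.
  rewrite !mxE; apply: le_trans ((Lx j).2 x z xr zr) _.
  exact: ler_wpM2r.
apply: norm_le => [|j]; first by rewrite mulr_ge0 // sqr_ge0.
have -> : (G z - G x - H x *m (z - x)) j 0 =
    G z j 0 - G x j 0 - dot (row j (H x))^T (z - x).
  rewrite !mxE; congr (_ - _); apply: eq_bigr => k _.
  by rewrite !mxE.
apply: le_trans ((Cx j).2 x z xr zr) _.
by apply: ler_wpM2r; first exact: sqr_ge0.
Qed.

(** If [G] takes the same value at two points [x] and [y] of a small set, then
    [H x] nearly kills [y - x]; by symmetry the range of [H x] is nearly
    orthogonal to [y - x], so that the whole image of the small set is squeezed
    in that direction, to second order in the size of the set. *)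
Lemma fibre_squeeze r : exists2 C, 0 <= C &
  forall (delta : R) (Q : set V) x y, 0 <= delta ->
  (forall z, Q z -> `|z| <= r) ->
  (forall z z', Q z -> Q z' -> `|z - z'| <= delta) ->
  Q x -> Q y -> G x = G y ->
  forall z z', Q z -> Q z' ->
  `|G z - G z'| <= C * delta /\
  `|dot (G z - G z') (y - x)| <= C * delta ^+ 2 * `|y - x|.
Proof.
have [C C0 CG] := field_expansion r; pose m : R := n.+1%:R.
have m1 : 1 <= m by rewrite ler1n.
exists (4 * m * C) => [|delta Q x y d0 Qr Qd Qx Qy Gxy].
  by rewrite !mulr_ge0.
pose v := y - x; have vd : `|v| <= delta by exact: Qd.
have Hv : `|H x *m v| <= C * `|v| ^+ 2.
  have [_] := CG x y (Qr _ Qx) (Qr _ Qy).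
  by rewrite Gxy subrr sub0r normrN.
have one z : Q z -> `|dot (G z - G x) v| <= 2 * m * C * delta ^+ 2 * `|v|.
  move=> Qz; have [_ rem] := CG x z (Qr _ Qx) (Qr _ Qz).
  have zd : `|z - x| <= delta by exact: Qd.
  rewrite -(subrK (H x *m (z - x)) (G z - G x)) dotDl.
  apply: le_trans (ler_normD _ _) _.
  have -> : 2 * m * C * delta ^+ 2 * `|v| =
    m * (C * delta ^+ 2) * `|v| + m * delta * (C * (`|v| * delta)) by ring.
  have m0 : 0 <= m by rewrite ler0n.
  apply: lerD.
    apply: le_trans (dot_le _ _) _; apply: ler_wpM2r => //.
    apply: ler_wpM2l => //; apply: le_trans rem _; apply: ler_wpM2l => //.
    by rewrite lerXn2r ?nnegrE.
  rewrite dotC dot_sym //; apply: le_trans (dot_le _ _) _.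
  apply: ler_pM => //.
    exact: ler_wpM2l.
  apply: le_trans Hv _; rewrite expr2; apply: ler_wpM2l => //.
  exact: ler_wpM2l.
move=> z z' Qz Qz'; split.
  have [Gz _] := CG z' z (Qr _ Qz') (Qr _ Qz).
  apply: le_trans Gz _; apply: ler_pM => //; last exact: Qd.
  by rewrite -[leLHS]mul1r ler_wpM2r //; lra.
have -> : G z - G z' = (G z - G x) - (G z' - G x) by rewrite opprB addrA subrK.
rewrite dotDl dotNl; apply: le_trans (ler_normB _ _) _.
by apply: le_trans (lerD (one _ Qz) (one _ Qz')) _; lra.
Qed.

(** Cut the ball into cells of side of order [1 / N] and look at
    [N ^ 2] values per coordinate for [a].  By [fibre_squeeze] a cell in which
    the fibre of [a] has two points accounts for at most
    [O(N ^ n)] of the [N ^ (2 * n.+1)] grid values; there are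
    [O(N ^ n.+1)] cells, and so for large [N] some grid value
    has at most one point of its fibre in each cell. *)
Lemma generic_fibre_finite r eta : 0 < eta ->
  exists2 a, `|a| <= eta & finite_set [set x | `|x| <= r /\ G x = a].
Proof.
(* Enlarging [r] makes the cells nondegenerate. *)
wlog r0 : r / 0 < r => [hw eta0|eta0].
  have [|a aeta afin] := hw (`|r| + 1) _ eta0; first by rewrite ltr_wpDl.
  exists a => //; apply: sub_finite_set afin => x /= [xr ->]; split=> //.
  by rewrite (le_trans xr) // (le_trans (ler_norm r)) // lerDl.
have [C C0 sq] := fibre_squeeze r.
have up (t : R) : t <= (Num.truncn t).+1%:R.
  have [t0|t0] := leP 0 t; first by have /andP[_ /ltW] := truncn_itv t0.
  by rewrite (le_trans (ltW t0)).
(* The image of a cell spans at most [a * N] grid steps in each coordinate,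
   and [b] steps along the direction in which it is squeezed. *)
pose a := (Num.truncn (C * (2 * r) / eta)).+1.
pose b := (Num.truncn (C * (2 * r) ^+ 2 / eta)).+1.
have [N N0 count] := grid_count n a b.
have NR : 0 < N%:R :> R by rewrite ltr0n.
pose delta : R := 2 * r / N%:R.
have d0 : 0 < delta by rewrite divr_gt0 // mulr_gt0.
pose s : R := eta / (N ^ 2)%:R.
have s0 : 0 < s by rewrite divr_gt0 // ltr0n expn_gt0 N0.
pose grid (m : {ffun 'I_n.+1 -> 'I_(N ^ 2)}) : V := \col_i (s * (m i)%:R).
pose cell (x : V) : {ffun 'I_n.+1 -> 'I_N.+1} :=
  [ffun i => inord (Num.truncn ((x i 0 + r) / delta))].
have cell_near x y : `|x| <= r -> `|y| <= r -> cell x = cell y ->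
    `|x - y| <= delta.
  move=> xr yr /ffunP cxy; apply: norm_le => [|i]; first exact: ltW.
  have coord (z : V) : `|z| <= r -> 0 <= (z i 0 + r) / delta /\
      (Num.truncn ((z i 0 + r) / delta)%R < N.+1)%N.
    move=> zr; have /ler_normlP[z1 z2] := le_trans (coord_le z i) zr.
    have z0 : 0 <= (z i 0 + r) / delta by apply: divr_ge0; [lra|exact: ltW].
    split=> //; have /andP[tz _] := truncn_itv z0.
    rewrite ltnS -(ler_nat R); apply: le_trans tz _.
    rewrite ler_pdivrMr // /delta mulrC divfK ?gt_eqF //; lra.
  have [x0 xN] := coord x xr; have [y0 yN] := coord y yr.
  have := congr1 (@nat_of_ord _) (cxy i); rewrite !ffunE !inordK // => xy.
  have /andP[x1 x2] := truncn_itv x0; have /andP[y1 y2] := truncn_itv y0.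
  rewrite xy in x1 x2.
  rewrite ler_pdivlMr // in x1; rewrite ler_pdivlMr // in y1.
  rewrite ltr_pdivrMr // in x2; rewrite ltr_pdivrMr // in y2.
  rewrite -natr1 mulrDl mul1r in x2; rewrite -natr1 mulrDl mul1r in y2.
  by rewrite !mxE; apply/ler_normlP; split; lra.
(* The grid values with two points of their fibre in the cell [q]. *)
pose bad (q : {ffun 'I_n.+1 -> 'I_N.+1}) : {set {ffun 'I_n.+1 -> 'I_(N ^ 2)}} :=
  [set m | `[< exists x y, [/\ x != y, `|x| <= r /\ `|y| <= r,
     cell x = q /\ cell y = q & G x = grid m /\ G y = grid m] >]]%SET.
have badP q : (#|bad q| <= (a * N).+1 ^ n * b.+1)%N.
  have [->|[m0]] := set_0Vmem (bad q); first by rewrite cards0.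
  rewrite inE => /asboolP[x [y [xy [xr yr] [cx cy] [Gx Gy]]]].
  have v0 : y - x != 0 by rewrite subr_eq0 eq_sym.
  (* The slab is transverse to the largest coordinate of its normal. *)
  have [i vi] := norm_attained v0.
  pose Q z := `|z| <= r /\ cell z = q.
  have pts m : m \in bad q -> exists2 z, Q z & G z = grid m.
    by rewrite inE => /asboolP[z [_ [_ [zr _] [cz _] [Gz _]]]]; exists z.
  have Qd z z' : Q z -> Q z' -> `|z - z'| <= delta.
    by move=> [zr cz] [zr' cz']; apply: cell_near => //; rewrite cz cz'.
  have := sq delta Q x y (ltW d0) (fun z Qz => Qz.1) Qd (conj xr cx) (conj yr cy).
  rewrite Gx Gy => /(_ erefl) squeeze.
  have natD (m m' k : nat) : s * m%:R - s * m'%:R <= s * k%:R ->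
      (m <= m' + k)%N.
    by rewrite -mulrBr ler_pM2l // lerBlDl -natrD ler_nat.
  have sE : s * N%:R ^+ 2 = eta by rewrite /s natrX divfK // expf_neq0 // gt_eqF.
  apply: (card_thin (i := i)) => [m m' j mB mB'|m m' mB mB' mm'].
    have [z Qz Gz] := pts m mB; have [z' Qz' Gz'] := pts m' mB'.
    have [dz _] := squeeze z z' Qz Qz'; rewrite Gz Gz' in dz.
    have := le_trans (coord_le _ j) dz; rewrite !mxE => /ler_normlP[_ dj].
    apply: natD; apply: le_trans dj _.
    have := up (C * (2 * r) / eta); rewrite ler_pdivrMr // -/a -sE => le.
    rewrite /delta mulrA ler_pdivrMr // natrM.
    by apply: le_trans le _; rewrite le_eqVlt; apply/orP; left; apply/eqP; ring.
  have [z Qz Gz] := pts m mB; have [z' Qz' Gz'] := pts m' mB'.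
  have [_] := squeeze z z' Qz Qz'; rewrite Gz Gz'.
  rewrite /dot (bigD1 i) //= big1 => [|j ji]; last first.
    by rewrite !mxE mm' // subrr mul0r.
  rewrite addr0 normrM vi ler_pM2r ?normr_gt0 // !mxE => /ler_normlP[_ di].
  apply: natD; apply: le_trans di _.
  have := up (C * (2 * r) ^+ 2 / eta); rewrite ler_pdivrMr // -/b -sE => le.
  rewrite /delta expr_div_n mulrA ler_pdivrMr ?exprn_gt0 //.
  by apply: le_trans le _; rewrite le_eqVlt; apply/orP; left; apply/eqP; ring.
have [m mgood] : exists m, forall q, m \notin bad q.
  apply/not_existsP => /= allbad.
  have cover : [set: {ffun 'I_n.+1 -> 'I_(N ^ 2)}]%SET \subset (\bigcup_q bad q)%SET.
    apply/fintype.subsetP => m _; apply/bigcupP; apply: contrapT => mq.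
    apply: (allbad m) => q; apply/negP => mb; apply: mq; by exists q.
  have := subset_leq_card cover; rewrite cardsT card_ffun !card_ord.
  apply/negP; rewrite -ltnNge; apply: (leq_ltn_trans _ count).
  apply: leq_trans (card_bigcup_le bad) _.
  pose k := ((a * N).+1 ^ n * b.+1)%N.
  apply: (@leq_trans (\sum_(q : {ffun 'I_n.+1 -> 'I_N.+1}) k)%N).
    by apply: leq_sum => q _; exact: badP.
  by rewrite sum_nat_const card_ffun !card_ord.
exists (grid m).
  apply: norm_le => [|i]; first exact: ltW.
  rewrite mxE (ger0_norm (mulr_ge0 (ltW s0) (ler0n _ _))).
  rewrite /s mulrAC ler_pdivrMr ?ltr0n ?expn_gt0 ?N0 //.
  by rewrite ler_pM2l // ler_nat ltnW.
(* A point of the fibre is determined by its cell. *)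
pose pt q := get [set x | [/\ `|x| <= r, G x = grid m & cell x = q]].
apply: (@sub_finite_set _ _ (pt @` setT)); last first.
  by apply: finite_image; exact: finite_finset.
move=> x /= [xr Gx]; exists (cell x) => //.
have [pr Gp cp] : [set y | [/\ `|y| <= r, G y = grid m & cell y = cell x]]
    (pt (cell x)) by apply: (@getI _ _ x).
apply/eqP; apply: contraT => px; have := mgood (cell x).
rewrite inE => /negP; case; apply/asboolP; exists (pt (cell x)), x.
by split.
Qed.

End GenericFibre.
(** * Positive definite matrices *)

Section PosDef.
Variable (R : realType).

Lemma pos_def_dot d (A : 'M[R]_d) x : pos_def A -> x != 0 -> 0 < dot x (A *m x).
Proof. by move=> [_ Ax] /Ax; rewrite -mulmxA dotE. Qed.

Lemma pos_def_unit d (A : 'M[R]_d) : pos_def A -> A \in unitmx.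
Proof.
move=> pA; rewrite -row_free_unit -kermx_eq0; apply/eqP.
apply: contraPP (I) => /eqP/rowV0Pn[u /sub_kermxP uA u0] _.
have /(pos_def_dot pA) : u^T != 0 by rewrite trmx_eq0.
by rewrite dot_mulmx -trmx_mul uA trmx0 dot0l ltxx.
Qed.

Lemma pos_def_inv d (A : 'M[R]_d) : pos_def A -> pos_def (invmx A).
Proof.
move=> pA; have uA := pos_def_unit pA; have sA := pA.1.
have siA : (invmx A)^T = invmx A by rewrite trmx_inv sA.
split=> // x x0; rewrite -mulmxA dotE.
have y0 : invmx A *m x != 0.
  by apply: contraNneq x0 => y0; rewrite -(mulKVmx uA x) y0 mulmx0.
by have := pos_def_dot pA y0; rewrite mulKVmx // dotC.
Qed.

Lemma pos_def1 d : pos_def (1%:M : 'M[R]_d).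
Proof.
split=> [|x x0]; first by rewrite trmx1.
rewrite -mulmxA mul1mx dotE lt_neqAle dot_ge0 andbT eq_sym.
by apply: contraNneq x0 => /dot_eq0 ->.
Qed.

(** Compactness of the unit sphere. *)
Lemma pos_def_coercive d (A : 'M[R]_d) : pos_def A ->
  exists2 l, 0 < l & forall x, l * `|x| ^+ 2 <= dot x (A *m x).
Proof.
move=> pA; pose S := [set x : 'cV[R]_d | `|x - 0| = 1].
have scal x : x != 0 -> S (`|x|^-1 *: x).
  move=> x0; rewrite /S /= subr0 mx_normZ ger0_norm ?invr_ge0 //.
  by rewrite mulVf // normr_eq0.
have [Se|/set0P S0] := eqVneq S set0.
  exists 1 => // x; have [->|/scal] := eqVneq x 0; last by rewrite Se.
  by rewrite normr0 mulmx0 dot0l expr0n mulr0.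
have [m Sm mS] := compact_max (@sphere_compact R d 0 1) S0
  (smooth_continuous (smooth_quadratic 0 pA.1)).
have m0 : m != 0.
  by apply: contra_eqN Sm => /eqP ->; rewrite subrr normr0 eq_sym oner_eq0.
exists (dot m (A *m m)) => [|x]; first exact: pos_def_dot.
have [->|x0] := eqVneq x 0.
  by rewrite normr0 mulmx0 dot0l expr0n mulr0.
have := mS _ (scal x x0); rewrite !subr0 -scalemxAr dotZl dotZr.
have n0 : 0 < `|x| by rewrite normr_gt0.
move: (dot x _) (dot m _) => u v uv.
rewrite -ler_pdivlMr ?exprn_gt0 //.
have -> : u / `|x| ^+ 2 = `|x|^-1 * (`|x|^-1 * u) by field; rewrite gt_eqF.
by move: uv; lra.
Qed.

Lemma pos_def_block d1 d2 (A : 'M[R]_d1) (B : 'M[R]_d2) :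
  pos_def A -> pos_def B -> pos_def (block_mx A 0 0 B).
Proof.
move=> pA pB; split=> [|x].
  by rewrite tr_block_mx pA.1 pB.1 !trmx0.
rewrite -(vsubmxK x); move: (usubmx x) (dsubmx x) => u v uv0.
rewrite -mulmxA mul_block_col !mul0mx add0r addr0 tr_col_mx mul_row_col mxE.
rewrite !dotE.
have ge (d : nat) (C : 'M[R]_d) w : pos_def C -> 0 <= dot w (C *m w).
  move=> pC; have [->|w0] := eqVneq w 0; first by rewrite mulmx0 dot0l.
  exact/ltW/pos_def_dot.
have [u0|u0] := eqVneq u 0; last by rewrite ltr_wpDr ?ge ?pos_def_dot.
have [v0|v0] := eqVneq v 0; last by rewrite ltr_wpDl ?ge ?pos_def_dot.
by rewrite u0 v0 col_mx0 eqxx in uv0.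
Qed.

End PosDef.
(** * Sums of Gaussian bumps and their tilts *)

(** Otherwise moving from [x] a small step along [g x] increases [phi]: the
    linear gain beats the quadratic remainder. *)
Lemma mode_critical (R : realType) (d : nat) (phi : 'cV[R]_d -> R) g x :
  smooth phi g -> Mode phi x -> g x = 0.
Proof.
move=> pg /ModeP[r r0 xmax]; apply: dot_eq0; apply/eqP.
rewrite eq_le dot_ge0 andbT leNgt; apply/negP => D0.
have [C C0 Cx] := pg (`|x| + 1).
have small (q b : R) : 0 < b ->
    exists2 e, 0 < e & forall t, 0 < t -> t <= e -> t * q < b.
  move=> b0; have q1 : 0 < `|q| + 1 by rewrite ltr_wpDl.
  exists (b / (`|q| + 1)) => [|t t0]; first exact: divr_gt0.
  rewrite ler_pdivlMr // => tb; apply: lt_le_trans tb.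
  by rewrite ltr_pM2l // (le_lt_trans (ler_norm q)) // ltrDl.
have [e1 e10 h1] := small `|g x| r r0.
have [e2 e20 h2] := small `|g x| 1 ltr01.
have [e3 e30 h3] := small (C * `|g x| ^+ 2) _ D0.
pose t := Num.min e1 (Num.min e2 e3).
have t0 : 0 < t by rewrite !lt_min e10 e20.
have te1 : t <= e1 by rewrite ge_min lexx.
have te2 : t <= e2 by rewrite !ge_min lexx orbT.
have te3 : t <= e3 by rewrite !ge_min lexx !orbT.
have tg : `|(x + t *: g x) - x| = t * `|g x|.
  by rewrite addrC addKr mx_normZ gtr0_norm.
have up := xmax (x + t *: g x); rewrite tg in up.
have zr : `|x + t *: g x| <= `|x| + 1.
  apply: le_trans (ler_normD _ _) _; rewrite lerD2l mx_normZ gtr0_norm //.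
  exact: ltW (h2 t t0 te2).
have xr : `|x| <= `|x| + 1 by rewrite lerDl.
have [_ _] := Cx _ _ xr zr; rewrite tg => /ler_normlP[lo _].
have {}up := up (h1 t t0 te1).
have dE : dot (g x) (x + t *: g x - x) = t * dot (g x) (g x).
  by rewrite addrC addKr dotZr.
rewrite dE in lo; have := h3 t t0 te3; rewrite -(ltr_pM2l t0).
move: lo up; rewrite exprMn expr2; lra.
Qed.

Section GaussSum.
Variables (R : realType) (I : finType) (n : nat).
Notation V := 'cV[R]_n.
Variables (c : I -> R) (mu : I -> V) (A : I -> 'M[R]_n).
Hypothesis c_gt0 : forall i, 0 < c i.
Hypothesis A_pd : forall i, pos_def (A i).

(** The Gaussian profile of precision matrix [B], with height [1]. *)
Definition bump (B : 'M[R]_n) (m x : V) : R :=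
  expR (- (1 / 2) * dot (x - m) (B *m (x - m))).

Definition gterm i x := c i * bump (A i) (mu i) x.
Definition gsum x := \sum_i gterm i x.
Definition gslope i x := A i *m (mu i - x).
Definition ggrad x := \sum_i gterm i x *: gslope i x.

Lemma gterm_gt0 i x : 0 < gterm i x.
Proof. by rewrite mulr_gt0 // expR_gt0. Qed.

Lemma gsum_gt0 (i0 : I) x : 0 < gsum x.
Proof.
rewrite /gsum (bigD1 i0) //= ltr_wpDr ?gterm_gt0 //.
by apply: sumr_ge0 => i _; rewrite ltW // gterm_gt0.
Qed.

Lemma bump_le1 B m x : pos_def B -> bump B m x <= 1.
Proof.
move=> pB; rewrite -[leRHS]expR0 ler_expR; have [l l0 lB] := pos_def_coercive pB.
have := lB (x - m); have := mulr_ge0 (ltW l0) (sqr_ge0 `|x - m|); lra.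
Qed.

Lemma smooth_gterm i : smooth (gterm i) (fun x => gterm i x *: gslope i x).
Proof.
have := smoothM (@smooth_cst R n (c i))
  (smooth_expR (smooth_quadratic (mu i) (A_pd i).1)).
by apply: smooth_ext => x //; rewrite scaler0 addr0 scalerA.
Qed.

Lemma smooth_gsum : smooth gsum ggrad.
Proof. exact: smooth_sum smooth_gterm. Qed.

Lemma gsum_le x : gsum x <= \sum_i c i.
Proof.
by apply: ler_sum => i _; rewrite ler_piMr ?bump_le1 // ltW.
Qed.

(** From [exp (- t) <= 1 / (1 + t)] and the coercivity of [B]. *)
Lemma bump_decay B m e : pos_def B -> 0 < e ->
  exists2 r, 0 <= r & forall x, r <= `|x| -> bump B m x <= e.
Proof.
move=> pB e0; have [l l0 lB] := pos_def_coercive pB.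
exists (`|m| + 1 + 2 / (l * e)) => [|x xr].
  by rewrite !addr_ge0 // divr_ge0 // mulr_ge0 // ltW.
have le0 : 0 < l * e by rewrite mulr_gt0.
have K0 : 0 < 2 / (l * e) by rewrite divr_gt0.
have xm : 1 + 2 / (l * e) <= `|x - m|.
  by have := ler_distD m x 0; rewrite !subr0; lra.
have sq : 2 / (l * e) <= `|x - m| ^+ 2.
  apply: (@le_trans _ _ `|x - m|); first by lra.
  by rewrite expr2 ler_peMr //; lra.
have q : e^-1 <= 1 / 2 * dot (x - m) (B *m (x - m)).
  have := lB (x - m); have : l * (2 / (l * e)) <= l * `|x - m| ^+ 2.
    by rewrite ler_pM2l.
  have -> : l * (2 / (l * e)) = 2 * e^-1 by field; rewrite !gt_eqF.
  by lra.
rewrite /bump mulNr expRN -[leRHS]invrK lef_pV2 ?posrE ?expR_gt0 ?invr_gt0 //.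
apply: le_trans q _; apply: le_trans (expR_ge1Dx _).
by rewrite lerDr.
Qed.

Lemma gsum_decay e : 0 < e ->
  exists2 r, 0 <= r & forall x, r <= `|x| -> gsum x <= e.
Proof.
move=> e0; have C0 : 0 <= \sum_i c i by apply: sumr_ge0 => i _; exact: ltW.
have C1 : 0 < \sum_i c i + 1 by rewrite ltr_wpDl.
have e'0 : 0 < e / (\sum_i c i + 1) by rewrite divr_gt0.
have /choice[r ri] : forall i, exists r, 0 <= r /\
    forall x, r <= `|x| -> bump (A i) (mu i) x <= e / (\sum_i c i + 1).
  by move=> i; have [r r0 rx] := bump_decay (mu i) (A_pd i) e'0; exists r.
exists (\sum_i r i) => [|x xr].
  by apply: sumr_ge0 => i _; exact: (ri i).1.
apply: (@le_trans _ _ (\sum_i c i * (e / (\sum_i c i + 1)))).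
  apply: ler_sum => i _; rewrite ler_pM2l //; apply: (ri i).2.
  apply: le_trans xr; rewrite (bigD1 i) //= lerDl.
  by apply: sumr_ge0 => j _; exact: (ri j).1.
by rewrite -mulr_suml mulrA ler_pdivrMr // mulrC ler_pM2l // lerDl.
Qed.

(** Adds the linear form [dot a] to the logarithm of [f]. *)
Definition tilt (a : V) (f : V -> R) x := f x * expR (dot a x).

(** The vanishing gradient of [tilt a f], divided by the exponential factor. *)
Lemma tilt_critical a x :
  Mode (tilt a gsum) x -> ggrad x + gsum x *: a = 0.
Proof.
have sE : smooth (fun x : V => expR (dot a x)) (fun x => expR (dot a x) *: a).
  apply: smooth_ext (smooth_expR (smooth_affine a 0)) => y; by rewrite addr0.
move=> /(mode_critical (smoothM smooth_gsum sE)) /eqP.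
rewrite scalerA mulrC -scalerA -scalerDr scaler_eq0 gt_eqF ?expR_gt0 //=.
by rewrite addrC => /eqP.
Qed.

(** At a critical point the scalar product with [x] of the gradient of [tilt a
    f] vanishes. Each component contributes at most a linear term in [|x|]
    minus the coercive quadratic term, hence a negative number once [|x|] is
    large. *)
Lemma tilt_modes_bounded (i0 : I) : exists r, forall a x,
  `|a| <= 1 -> Mode (tilt a gsum) x -> `|x| <= r.
Proof.
have [l l0 lA] : exists2 l, 0 < l &
    forall i, i \in enum I -> forall x, l * `|x| ^+ 2 <= dot x (A i *m x).
  apply: common_eps => [i e e' _ ee' eA x|i _]; last exact: pos_def_coercive.
  by apply: le_trans (eA x); rewrite ler_wpM2r ?sqr_ge0.
pose B := \sum_i `|A i *m mu i|; exists ((n%:R * (B + 1)) / l) => a x a1 mx.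
rewrite leNgt; apply/negP; rewrite ltr_pdivrMr // => big.
have x0 : 0 < `|x|.
  rewrite normr_gt0; apply: contraTneq big => ->; rewrite normr0 mul0r -leNgt.
  by rewrite mulr_ge0 // addr_ge0 // sumr_ge0.
have neg i : dot (gslope i x + a) x < 0.
  have Bi : `|A i *m mu i| <= B.
    by rewrite /B (bigD1 i) //= lerDl sumr_ge0.
  rewrite /gslope mulmxBr !dotDl dotNl (dotC (A i *m x)).
  have /ler_normlP[_ h1] := dot_le (A i *m mu i) x.
  have /ler_normlP[_ h2] := dot_le a x.
  have h3 := lA i (mem_enum _ _) x.
  have h4 : n%:R * `|A i *m mu i| * `|x| <= n%:R * B * `|x|.
    by rewrite ler_wpM2r // ler_wpM2l.
  have h5 : n%:R * `|a| * `|x| <= n%:R * 1 * `|x|.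
    by rewrite ler_wpM2r // ler_wpM2l.
  have h6 : n%:R * (B + 1) * `|x| < `|x| * l * `|x| by rewrite ltr_pM2r.
  by move: h3; rewrite expr2; lra.
have := tilt_critical mx => /(congr1 (fun u => dot u x)); apply/eqP.
have -> : ggrad x + gsum x *: a = \sum_i gterm i x *: (gslope i x + a).
  by rewrite /gsum scaler_suml -big_split; apply: eq_bigr => i _; rewrite scalerDr.
rewrite dot0l dot_suml lt_eqF // (bigD1 i0) //=; apply: ltr_wnDr.
  by apply: sumr_le0 => i _; rewrite dotZl ltW // pmulr_rlt0 ?gterm_gt0.
by rewrite dotZl pmulr_rlt0 ?gterm_gt0.
Qed.

End GaussSum.
Section GenericTilt.
Variables (R : realType) (I : finType) (n : nat).
Notation V := 'cV[R]_n.+1.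
Variables (c : I -> R) (mu : I -> V) (A : I -> 'M[R]_n.+1).
Hypothesis c_gt0 : forall i, 0 < c i.
Hypothesis A_pd : forall i, pos_def (A i).
Variable i0 : I.

Notation f := (gsum c mu A).
Notation e := (gterm c mu A).
Notation l := (gslope mu A).
Notation P := (ggrad c mu A).

Lemma smooth_gsum_inv : smooth (fun x => (f x)^-1) (fun x => - (f x)^-2 *: P x).
Proof.
apply: smooth_inv; first exact: smooth_gsum.
move=> r; have [C C0 Cx] := smooth_quadratic (mu i0) (A_pd i0).1 r.
exists (c i0 * expR (- C)) => [|x xr]; first by rewrite mulr_gt0 ?expR_gt0.
have [/ler_normlP[q _] _ _] := Cx x x xr xr.
apply: (@le_trans _ _ (e i0 x)).
  by rewrite ler_pM2l // ler_expR; lra.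
rewrite /gsum (bigD1 i0) //= lerDl.
by apply: sumr_ge0 => i _; rewrite ltW // gterm_gt0.
Qed.

(** The gradient of [ln f], and its Jacobian: the Hessian of [ln f], whence the
    symmetry. *)
Definition log_grad x : V := (f x)^-1 *: P x.

Definition log_hess x : 'M[R]_n.+1 := \matrix_(j, k)
  ((f x)^-1 * (\sum_i e i x * (l i x j 0 * l i x k 0 - A i j k))
   - (f x)^-2 * (P x j 0 * P x k 0)).

Lemma log_hess_sym x : (log_hess x)^T = log_hess x.
Proof.
apply/matrixP => j k; rewrite !mxE; congr (_ * _ - _ * _); last exact: mulrC.
apply: eq_bigr => i _; congr (_ * (_ - _)); first exact: mulrC.
by rewrite -[in LHS](A_pd i).1 mxE.
Qed.

Lemma smooth_log_grad j :
  smooth (fun x => log_grad x j 0) (fun x => (row j (log_hess x))^T).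
Proof.
have sl i : smooth (fun x => l i x j 0) (fun=> - (row j (A i))^T).
  apply: smooth_ext (smooth_affine _ ((A i *m mu i) j 0)) => x //.
  rewrite dotNl /gslope mulmxBr [RHS]mxE [RHS]addrC; congr (_ + _).
  by rewrite !mxE; congr (- _); apply: eq_bigr => k _; rewrite !mxE.
have := smoothM smooth_gsum_inv
  (smooth_sum (fun i => smoothM (smooth_gterm c mu A_pd i) (sl i))).
apply: smooth_ext => x.
  rewrite mxE; congr (_ * _); rewrite summxE; apply: eq_bigr => i _.
  by rewrite [RHS]mxE.
apply/colP => k; rewrite !mxE.
have -> : P x j 0 = \sum_i e i x * l i x j 0.
  by rewrite summxE; apply: eq_bigr => i _; rewrite [LHS]mxE.
rewrite summxE; congr (_ * _ + _); last by ring.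
by apply: eq_bigr => i _; rewrite !mxE; ring.
Qed.

(** The modes of [tilt a f] solve [log_grad x = - a] and stay in a fixed ball,
    where the equation has finitely many solutions for suitable small [a]. *)
Lemma generic_tilt_finite eta : 0 < eta ->
  exists2 a, `|a| <= eta & finite_set (Mode (tilt a f)).
Proof.
move=> eta0; have [r tr] := tilt_modes_bounded mu c_gt0 A_pd i0.
have m0 : 0 < Num.min eta 1 by rewrite lt_min eta0 ltr01.
have [a] := generic_fibre_finite smooth_log_grad log_hess_sym r m0.
rewrite le_min => /andP[aeta a1] fin; exists (- a); first by rewrite normrN.
apply: sub_finite_set fin => x xm /=; split; first by apply: tr xm; rewrite normrN.
have /eqP := tilt_critical A_pd xm.
rewrite scalerN subr_eq0 /log_grad => /eqP ->.
by rewrite scalerA mulVf ?scale1r // gt_eqF // (gsum_gt0 _ _ c_gt0 i0).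
Qed.

End GenericTilt.
(** * Stable local maxima *)

Section Peaks.
Variables (R : realType) (d : nat).
Notation V := 'cV[R]_d.
Implicit Types (f : V -> R) (s : seq V) (x y z : V).

(** A quantitative, hence stable, form of having a strict local maximum near
    each point of [s]. *)
Definition peaks f s (r eta : R) :=
  [/\ 0 < r, 0 < eta,
      forall x y, x \in s -> y \in s -> x != y -> 2 * r < `|x - y| &
      forall x y, x \in s -> `|y - x| = r -> f y + eta <= f x].

(** When the modes are finite in number they are strict: a point near a mode
    with the same value would be another mode. *)
Lemma finite_modes_peaks f s : continuous f -> finite_set (Mode f) ->
  (forall x, x \in s -> Mode f x) -> exists r eta, peaks f s r eta.
Proof.
move=> cf /finite_seqP[t tE] sM.
have st x : x \in s -> x \in t.
  by move/sM; rewrite tE.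
have [e0 e00 sep] : exists2 e, 0 < e & forall x, x \in t ->
    forall y, y \in t -> y != x -> 2 * e < `|x - y|.
  apply: common_eps => [x e e' e'0 ee' h y yt yx|x xt].
    by apply: le_lt_trans (h y yt yx); rewrite ler_pM2l.
  apply: common_eps => [y e e' e'0 ee' h yx|y yt].
    by apply: le_lt_trans (h yx); rewrite ler_pM2l.
  have [->|yx] := eqVneq y x; first by exists 1.
  have xy : 0 < `|x - y| by rewrite normr_gt0 subr_eq0 eq_sym.
  by exists (`|x - y| / 3) => [|_]; lra.
have [r r0 strict] : exists2 e, 0 < e & forall x, x \in s ->
    e <= e0 /\ forall y, 0 < `|y - x| -> `|y - x| <= e -> f y < f x.
  apply: common_eps => [x e e' e'0 ee' [ee0 h]|x xs].
    split=> [|y y0 ye]; first exact: le_trans ee0.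
    by apply: h => //; exact: le_trans ee'.
  have [q q0 qmax] := (ModeP f x).1 (sM x xs).
  exists (Num.min e0 (q / 2)); first by rewrite lt_min e00 divr_gt0.
  split=> [|y y0]; first by rewrite ge_min lexx.
  rewrite le_min => /andP[ye0 yq].
  have fyx : f y <= f x by apply: qmax; lra.
  rewrite lt_neqAle fyx andbT; apply/eqP => fxy.
  have ymode : Mode f y.
    apply/ModeP; exists (q / 2) => [|z zy]; first by rewrite divr_gt0.
    rewrite fxy; apply: qmax; have := ler_distD y z x; lra.
  have yt : y \in t by move: ymode; rewrite tE.
  have yx : y != x by rewrite -subr_eq0 -normr_gt0.
  by have := sep x (st x xs) y yt yx; rewrite distrC; lra.
have [eta eta0 gap] : exists2 e, 0 < e & forall x, x \in s ->
    forall y, `|y - x| = r -> f y + e <= f x.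
  apply: common_eps => [x e e' e'0 ee' h y yr|x xs].
    by apply: le_trans (h y yr); rewrite lerD2l.
  have [S0|/set0P S0] := eqVneq [set y | `|y - x| = r] set0.
    exists 1 => // y yr; have : [set y | `|y - x| = r] y by [].
    by rewrite S0.
  have [m mr mmax] := compact_max (@sphere_compact R d x r) S0 cf.
  exists (f x - f m) => [|y yr]; last by have := mmax y yr; lra.
  rewrite subr_gt0; apply: (strict x xs).2; rewrite (mr : `|m - x| = r) //.
exists r, eta; split=> // [x y xs ys xy|x y xs]; last exact: gap.
apply: le_lt_trans (sep x (st x xs) y (st y ys) _); last by rewrite eq_sym.
by rewrite ler_pM2l //; exact: (strict x xs).1.
Qed.

(** The maximum of [f] on a closed ball of radius [r] around a point of [s] is
    not on the boundary, hence is a mode; the balls are disjoint. *)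
Lemma peaks_modes f s r eta : continuous f -> peaks f s r eta -> uniq s ->
  exists s', [/\ uniq s', size s' = size s & forall x, x \in s' -> Mode f x].
Proof.
move=> cf [r0 eta0 sep gap] us.
have /choice[m mE] : forall x, exists m, x \in s -> `|m - x| < r /\ Mode f m.
  move=> x; have [xs|] := boolP (x \in s); last by exists 0.
  have B0 : [set y | `|y - x| <= r] !=set0.
    by exists x; rewrite /= subrr normr0 ltW.
  have [m mr mmax] := compact_max (@closed_ball_compact R d x r) B0 cf.
  have mr' : `|m - x| < r.
    rewrite lt_neqAle (mr : `|m - x| <= r) andbT; apply/eqP => mr'.
    have xB : [set y | `|y - x| <= r] x by rewrite /= subrr normr0 ltW.
    by have := gap x m xs mr'; have := mmax x xB; lra.
  exists m => _; split=> //; apply/ModeP.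
  exists (r - `|m - x|) => [|y ym]; first by rewrite subr_gt0.
  by apply: mmax; have := ler_distD m y x; rewrite /=; lra.
exists (map m s); rewrite size_map; split=> //.
  rewrite map_inj_in_uniq // => x y xs ys mxy; apply/eqP; apply: contraT => xy.
  have := sep x y xs ys xy; have := ler_distD (m x) x y.
  have := (mE x xs).1; have := (mE y ys).1; rewrite -mxy (distrC (m x) x); lra.
by move=> _ /mapP[x xs ->]; exact: (mE x xs).2.
Qed.

Lemma seq_bounded s : exists r, forall x, x \in s -> `|x| <= r.
Proof.
elim: s => [|y s [r sr]]; first by exists 0.
exists (Num.max r `|y|) => x; rewrite inE le_max => /predU1P[->|/sr ->] //.
by rewrite lexx orbT.
Qed.

Lemma peaks_stable f s r eta : peaks f s r eta ->
  exists b, forall g, (forall x, `|x| <= b -> `|g x - f x| <= eta / 4) ->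
    peaks g s r (eta / 2).
Proof.
move=> [r0 eta0 sep gap]; have [b sb] := seq_bounded s.
exists (b + r) => g gf; split=> //; first by rewrite divr_gt0.
move=> x y xs yr; have xb := sb x xs.
have yb : `|y| <= b + r by have := ler_distD x y 0; rewrite !subr0; lra.
have xb' : `|x| <= b + r by lra.
have /ler_normlP[] := gf x xb'; have /ler_normlP[] := gf y yb.
by have := gap x y xs yr; lra.
Qed.

Lemma expR_near1 (t : R) : `|t| <= 1 / 2 -> `|expR t - 1| <= 2 * `|t|.
Proof.
move=> th; have := expR_ge1Dx t; have h := expR_ge1Dx (- t).
have e0 := expR_gt0 t; have h' : expR t * (1 - t) <= 1.
  by rewrite -[leRHS](expRxMexpNx_1 t) ler_pM2l.
have /ler_normlP[t1 t2] := th; move=> lo.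
have t0 := ler_norm t; have := ler_norm (- t); rewrite normrN => t0'.
have e2 : expR t <= 2.
  have := ler_wpM2l (ltW e0) t2; lra.
apply/ler_normlP; split; first by lra.
have [tp|tn] := leP 0 t.
  have := ler_wpM2r tp e2; rewrite (ger0_norm tp); lra.
have : expR t <= 1 by rewrite -[leRHS]expR0 ler_expR ltW.
by have := normr_ge0 t; lra.
Qed.

(** On a bounded set the factor [exp <a, x>] is uniformly close to [1]. *)
Lemma peaks_tilt f s r eta K : (forall x, `|f x| <= K) -> peaks f s r eta ->
  exists2 del, 0 < del &
    forall a, `|a| <= del -> peaks (tilt a f) s r (eta / 2).
Proof.
move=> fK pk; have [_ eta0 _ _] := pk; have [b stable] := peaks_stable pk.
have K0 : 0 <= K := le_trans (normr_ge0 _) (fK 0).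
pose q := d%:R * (`|b| + 1) + 1 : R.
have q0 : 0 < q by rewrite ltr_wpDl // mulr_ge0 // addr_ge0.
have p0 : 0 < 2 * (K + 1) by rewrite mulr_gt0 // ltr_wpDl.
pose del := Num.min (1 / 2) (eta / 4 / (2 * (K + 1))) / q.
exists del => [|a adel].
  by rewrite divr_gt0 // lt_min !divr_gt0.
apply: stable => x xb; have adx : `|dot a x| <= del * q.
  apply: le_trans (dot_le _ _) _.
  have -> : d%:R * `|a| * `|x| = `|a| * (d%:R * `|x|) by ring.
  apply: ler_pM => //; rewrite /q.
  have : d%:R * `|x| <= d%:R * (`|b| + 1).
    by rewrite ler_wpM2l //; have := ler_norm b; lra.
  by lra.
move: adx; rewrite /del divfK ?gt_eqF // le_min => /andP[t2 tK].
rewrite -[X in _ - X]mulr1 -mulrBr normrM.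
apply: (@le_trans _ _ ((K + 1) * (2 * `|dot a x|))).
  apply: ler_pM => //; last exact: expR_near1.
  by have := fK x; lra.
by move: tK; rewrite ler_pdivlMr //; lra.
Qed.

End Peaks.

(** The height [eta / 4] is below the gap of the peaks of [f], which therefore
    survive wherever the bump is centred. The centre [nu] can then be taken so
    far away that [f] does not compete with the bump near [nu]. *)
Lemma peaks_add_bump (R : realType) (n : nat) (f : 'cV[R]_n.+1 -> R)
    (B : 'M[R]_n.+1) s r eta :
  (forall x, 0 <= f x) ->
  (forall e, 0 < e -> exists2 r, 0 <= r & forall x, r <= `|x| -> f x <= e) ->
  pos_def B -> uniq s -> peaks f s r eta ->
  exists nu, [/\ 0 < eta / 4, uniq (nu :: s) &
    exists eta', peaks (fun x => f x + eta / 4 * bump B nu x) (nu :: s) r eta'].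
Proof.
move=> f0 fdecay pB us pk; have [r0 eta0 sep gap] := pk.
have [l l0 lB] := pos_def_coercive pB.
have e0 : 0 < eta / 4 by rewrite divr_gt0.
pose w := expR (- (1 / 2) * (l * r ^+ 2)).
have w1 : w < 1.
  rewrite -[ltRHS]expR0 ltr_expR; have := mulr_gt0 l0 (exprn_gt0 2 r0); lra.
pose k := eta / 4 * (1 - w).
have k0 : 0 < k by rewrite mulr_gt0 // subr_gt0.
have k2 : 0 < k / 2 by rewrite divr_gt0.
have [rho rho0 far] := fdecay _ k2.
have [b sb] := seq_bounded s.
pose T := rho + `|b| + 2 * r + 1; pose nu : 'cV[R]_n.+1 := const_mx T.
have T0 : 0 < T by rewrite /T; have := normr_ge0 b; lra.
have nuT : T <= `|nu|.
  by apply: le_trans (coord_le nu ord0); rewrite mxE ger0_norm // ltW.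
have nus x : x \in s -> 2 * r < `|nu - x|.
  move=> xs; have xb := sb x xs.
  have := ler_distD x nu 0; rewrite !subr0 => h; have := ler_norm b.
  by move: nuT; rewrite /T; lra.
exists nu; split=> //.
  rewrite /= us andbT; apply/negP => /nus; rewrite subrr normr0; lra.
have kb y : `|y - nu| = r -> bump B nu y <= w.
  by move=> yr; rewrite ler_expR; have := lB (y - nu); rewrite yr; lra.
exists (Num.min (k / 2) (eta / 2)); split=> //.
- by rewrite lt_min k2 divr_gt0.
- move=> x y; rewrite !inE => /predU1P[->|xs] /predU1P[->|ys] xy.
  + by rewrite eqxx in xy.
  + exact: nus.
  + by rewrite distrC; exact: nus.
  + exact: sep.
move=> x y; rewrite inE => /predU1P[->|xs] yr.
  have yfar : rho <= `|y|.
    have := ler_distD y nu 0; rewrite !subr0 (distrC nu) yr => h.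
    by have := normr_ge0 b; move: nuT; rewrite /T; lra.
  have fy := far y yfar; have := f0 nu.
  have nunu : bump B nu nu = 1.
    by rewrite /bump subrr mulmx0 dot0l mulr0 expR0.
  have : eta / 4 * bump B nu y <= eta / 4 * w by rewrite ler_pM2l // kb.
  have : Num.min (k / 2) (eta / 2) <= k / 2 by rewrite ge_min lexx.
  by rewrite nunu /k in fy *; lra.
have m2 : Num.min (k / 2) (eta / 2) <= eta / 2 by rewrite ge_min lexx orbT.
have g1 : eta / 4 * bump B nu y <= eta / 4 * 1.
  by rewrite ler_pM2l // bump_le1.
have g0 : 0 <= eta / 4 * bump B nu x by rewrite mulr_ge0 ?expR_ge0 // ltW.
by have := gap x y xs yr; lra.
Qed.
(** * Mixtures up to a positive factor *)

Section Mixtures.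
Variable (R : realType).

Lemma Mode_scale d (w : R) (f : 'cV[R]_d -> R) : 0 < w ->
  Mode (fun x => w * f x) = Mode f.
Proof.
move=> w0; apply/seteqP; split=> x [r r0 fr]; exists r => // y /fr.
  by rewrite ler_pM2l.
by rewrite ler_pM2l.
Qed.

Definition gauss_cst d (Sigma : 'M[R]_d) : R :=
  (2 * pi) `^ (- (d%:R / 2)) * (\det Sigma) `^ (- (1 / 2)).

Lemma gaussE d (m : 'cV[R]_d) Sigma x :
  gauss m Sigma x = gauss_cst Sigma * bump (invmx Sigma) m x.
Proof. by rewrite /gauss /bump -mulmxA dotE. Qed.

Lemma gauss_cst_gt0 d (Sigma : 'M[R]_d) : pos_def Sigma -> 0 < gauss_cst Sigma.
Proof.
move=> pS; apply: mulr_gt0; first by rewrite powR_gt0 // mulr_gt0 // pi_gt0.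
have := pos_def_unit pS; rewrite unitmxE unitfE => det0.
by rewrite /powR (negPf det0) expR_gt0.
Qed.

(** Homoscedasticity is required only for [hom = true], so that one argument
    serves both families of mixtures. *)
Definition realizable (hom : bool) d k M :=
  exists G : gauss_mixture R d k, [/\ hom -> homoscedastic G,
    finite_set (Mode (density G)) & exists s, [/\ uniq s, size s = M &
      forall x, x \in s -> Mode (density G) x]].

Lemma realizable_inhabited hom d k M : realizable hom d k M -> exists i : 'I_k, true.
Proof.
move=> [G _]; have := weight_sum1 G; case: k G => [|k] G.
  by rewrite big_ord0 => /eqP; rewrite eq_sym oner_eq0.
by exists ord0.
Qed.

(** A positive combination of Gaussian bumps is a multiple of a mixture density
    with the same covariances, and a positive factor does not move the modes:
    normalising constants and weights need no further care. *)
Lemma realizable_gsum (hom : bool) (I : finType) d c mu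
    (S : I -> 'M[R]_d) s (i0 : I) :
  (forall i, 0 < c i) -> (forall i, pos_def (S i)) ->
  (hom -> forall i j, S i = S j) ->
  finite_set (Mode (gsum c mu (fun i => invmx (S i)))) -> uniq s ->
  (forall x, x \in s -> Mode (gsum c mu (fun i => invmx (S i))) x) ->
  realizable hom d #|I| (size s).
Proof.
move=> c0 pS hS fin us sM.
pose w i := c i / gauss_cst (S i).
have w0 i : 0 < w i by rewrite divr_gt0 // gauss_cst_gt0.
pose W := \sum_i w i.
have W0 : 0 < W.
  by rewrite /W (bigD1 i0) //= ltr_wpDr // sumr_ge0 // => i _; rewrite ltW.
pose ev (i : 'I_#|I|) := enum_val i.
have re (F : I -> R) : \sum_(i < #|I|) F (ev i) = \sum_i F i.
  rewrite (reindex (@enum_val I predT)) //=.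
  by exists enum_rank => i _; rewrite (enum_valK, enum_rankK).
have sum1 : \sum_(i < #|I|) w (ev i) / W = 1.
  by rewrite (re (fun i => w i / W)) -mulr_suml divff // gt_eqF.
pose G := @GaussMixture R d #|I| (fun i => w (ev i) / W) (fun i => mu (ev i))
  (fun i => S (ev i)) (fun i => divr_gt0 (w0 _) W0) sum1 (fun i => pS _).
have GE : density G = (fun x => W^-1 * gsum c mu (fun i => invmx (S i)) x).
  apply/funext => x; have /= reG := re (fun i => w i / W * gauss (mu i) (S i) x).
  rewrite /density /= reG.
  rewrite /gsum mulr_sumr; apply: eq_bigr => i _; rewrite gaussE /gterm /w.
  by field; rewrite !gt_eqF ?gauss_cst_gt0.
exists G; rewrite GE Mode_scale ?invr_gt0 //; split=> //.
  by move=> h i j; exact: hS.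
by exists s.
Qed.

Lemma density_gsum d k (G : gauss_mixture R d k) :
  density G = gsum (fun i => weight G i * gauss_cst (cov G i)) (mean G)
    (fun i => invmx (cov G i)).
Proof.
by apply/funext => x; apply: eq_bigr => i _; rewrite gaussE mulrA.
Qed.

Lemma coef_gt0 d k (G : gauss_mixture R d k) i :
  0 < weight G i * gauss_cst (cov G i).
Proof. by rewrite mulr_gt0 ?weight_gt0 ?gauss_cst_gt0 //; exact: cov_pos_def. Qed.

(** A mode is a critical point, and the only critical point of a bump is its
    centre. *)
Lemma realizable_single hom d : realizable hom d 1 1.
Proof.
pose f := gsum (fun _ : unit => 1 : R) (fun=> 0 : 'cV[R]_d) (fun=> invmx 1%:M).
have fE x : f x = bump 1%:M 0 x.
  by rewrite /f /gsum big_const card_unit /= invmx1 /gterm mul1r addr0.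
have f0 : Mode f 0.
  exists 1 => // y _; rewrite !fE [leRHS]/bump subrr mulmx0 dot0l mulr0 expR0.
  by rewrite bump_le1 //; exact: pos_def1.
have mode0 x : Mode f x -> x = 0.
  have fS : smooth f (fun x => bump 1%:M 0 x *: (1%:M *m (0 - x))).
    have := smooth_expR (smooth_quadratic 0 (pos_def1 R d).1).
    by apply: smooth_ext => y //; rewrite fE.
  move=> /(mode_critical fS) /eqP.
  by rewrite scaler_eq0 gt_eqF ?expR_gt0 //= mul1mx sub0r oppr_eq0 => /eqP.
suff : realizable hom d #|{: unit}| (size [:: 0 : 'cV[R]_d]) by rewrite card_unit.
apply: (realizable_gsum (c := fun=> 1) (mu := fun=> 0) (S := fun=> 1%:M)) => //.
- by move=> _; exact: pos_def1.
- apply: (@sub_finite_set _ _ [set 0]) => [x /mode0 //|]; exact: finite_set1.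
by move=> x; rewrite inE => /eqP ->.
Qed.

(** Completing the square: tilting a Gaussian of covariance [S] by [a]
    translates it by [S *m a] and multiplies it by a constant. *)
Lemma tilt_gsum (I : finType) d (c : I -> R) mu (S : I -> 'M[R]_d) a :
  (forall i, pos_def (S i)) ->
  tilt a (gsum c mu (fun i => invmx (S i))) =
  gsum (fun i => c i * expR (dot a (mu i) + 1 / 2 * dot a (S i *m a)))
    (fun i => mu i + S i *m a) (fun i => invmx (S i)).
Proof.
move=> pS; apply/funext => x; rewrite /tilt /gsum mulr_suml.
apply: eq_bigr => i _; rewrite /gterm -!mulrA; congr (_ * _).
rewrite -!expRD; congr expR; set T := invmx (S i); set m := mu i.
have uS := pos_def_unit (pS i).
have sT : T^T = T by exact: (pos_def_inv (pS i)).1.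
have -> : x - (m + S i *m a) = (x - m) - S i *m a by rewrite opprD addrA.
have -> : x = (x - m) + m by rewrite subrK.
rewrite addrK; move: (x - m) => y.
rewrite mulmxBr (mulKmx uS) !dotDl !dotDr !dotNl !dotNr.
rewrite (dot_sym (S i *m a) y sT) (mulKmx uS).
by rewrite (dotC y a) (dotC (S i *m a) a); field.
Qed.

(** Add a far bump, which creates the new mode, then tilt, which makes the
    modal set finite while the peaks survive. *)
Lemma realizable_add hom n k M :
  realizable hom n.+1 k M -> realizable hom n.+1 k.+1 M.+1.
Proof.
move=> rG; have [i0 _] := realizable_inhabited rG.
have [G [hG fin [s [us <- sM]]]] := rG.
set c := fun i => weight G i * gauss_cst (cov G i).
have c0 i : 0 < c i := coef_gt0 G i.
have pS i : pos_def (cov G i) := cov_pos_def G i.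
have pA i : pos_def (invmx (cov G i)) := pos_def_inv (pS i).
set f := gsum c (mean G) (fun i => invmx (cov G i)).
have fE : density G = f := density_gsum G.
rewrite fE in fin sM.
have [r [eta pk]] := finite_modes_peaks
  (smooth_continuous (smooth_gsum c (mean G) pA)) fin sM.
have f0 x : 0 <= f x by apply: sumr_ge0 => i _; rewrite ltW // gterm_gt0.
have [nu [e0 unus [eta' pk']]] :=
  peaks_add_bump f0 (gsum_decay (mean G) c0 pA) (pA i0) us pk.
pose c' (o : 'I_k + unit) := if o is inl i then c i else eta / 4.
pose mu' (o : 'I_k + unit) := if o is inl i then mean G i else nu.
(* The new component takes the covariance of [i0], which keeps a homoscedastic
   mixture homoscedastic. *)
pose S' (o : 'I_k + unit) := cov G (if o is inl i then i else i0).
have c'0 o : 0 < c' o by case: o.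
have pS' o : pos_def (S' o) by exact: pS.
have pA' o : pos_def (invmx (S' o)) by exact: pA.
pose g := gsum c' mu' (fun o => invmx (S' o)).
have gE : (fun x => f x + eta / 4 * bump (invmx (cov G i0)) nu x) = g.
  apply/funext => x; rewrite /g /gsum big_sumType /= (bigD1 tt) //=.
  by rewrite [X in _ + (_ + X)]big_pred0 ?addr0 // => -[].
rewrite gE in pk'.
have gK x : `|g x| <= \sum_o c' o.
  rewrite ger0_norm; last by apply: sumr_ge0 => i _; rewrite ltW // gterm_gt0.
  exact: gsum_le.
have [del del0 pkt] := peaks_tilt gK pk'.
have [a adel fin'] := generic_tilt_finite mu' c'0 pA' (inr tt) del0.
have tE := tilt_gsum c' mu' a pS'; rewrite -/g in tE.
have [s' [us' ss' s'M]] : exists s', [/\ uniq s', size s' = size (nu :: s) &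
    forall x, x \in s' -> Mode (tilt a g) x].
  apply: peaks_modes (pkt a adel) unus.
  by rewrite tE; apply: smooth_continuous; exact: smooth_gsum pA'.
rewrite -/g tE in fin' s'M.
rewrite -[(size s).+1]/(size (nu :: s)) -ss'.
have <- : #|{: 'I_k + unit}| = k.+1 by rewrite card_sum card_unit card_ord addn1.
apply: realizable_gsum fin' us' s'M => //; first exact: (inr tt).
  by move=> o; rewrite mulr_gt0 ?expR_gt0.
by move=> h o o'; exact: hG.
Qed.

Lemma realizable_add_many hom n k M j :
  realizable hom n.+1 k M -> realizable hom n.+1 (j + k) (j + M).
Proof.
by move=> rG; elim: j => [//|j IH]; rewrite !addSn; exact: realizable_add.
Qed.

End Mixtures.
(** * Products of mixtures *)

Section Product.
Variable (R : realType).

Definition tensor d1 d2 (f1 : 'cV[R]_d1 -> R) (f2 : 'cV[R]_d2 -> R)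
  (x : 'cV[R]_(d1 + d2)) := f1 (usubmx x) * f2 (dsubmx x).

Lemma norm_col_mx_lt d1 d2 (u : 'cV[R]_d1) (v : 'cV[R]_d2) r : 0 < r ->
  `|col_mx u v| < r <-> `|u| < r /\ `|v| < r.
Proof.
move=> r0; split=> [uvr|[ur vr]].
  split; apply: norm_lt => // i; apply: le_lt_trans uvr.
    by rewrite -(col_mxEu u v); exact: coord_le.
  by rewrite -(col_mxEd u v); exact: coord_le.
apply: norm_lt => // i; case: (split_ordP i) => j ->.
  by rewrite col_mxEu; exact: le_lt_trans (coord_le _ _) ur.
by rewrite col_mxEd; exact: le_lt_trans (coord_le _ _) vr.
Qed.

(** A factor can be divided out when its argument is frozen, because it is
    positive; conversely nonnegative inequalities multiply. *)
Lemma Mode_tensor d1 d2 (f1 : 'cV[R]_d1 -> R) (f2 : 'cV[R]_d2 -> R) u v :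
  (forall x, 0 < f1 x) -> (forall x, 0 < f2 x) ->
  Mode (tensor f1 f2) (col_mx u v) <-> Mode f1 u /\ Mode f2 v.
Proof.
move=> p1 p2; rewrite !ModeP; split=> [[r r0 fr]|[[r r0 fr] [q q0 fq]]].
  split; exists r => // y yr.
    have := fr (col_mx y v); rewrite /tensor !col_mxKu !col_mxKd ler_pM2r //.
    apply; rewrite opp_col_mx add_col_mx subrr.
    by apply/norm_col_mx_lt => //; rewrite normr0.
  have := fr (col_mx u y); rewrite /tensor !col_mxKu !col_mxKd ler_pM2l //.
  apply; rewrite opp_col_mx add_col_mx subrr.
  by apply/norm_col_mx_lt => //; rewrite normr0.
have m0 : 0 < Num.min r q by rewrite lt_min r0.
exists (Num.min r q) => // y; rewrite -(vsubmxK y) opp_col_mx add_col_mx.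
move=> /(norm_col_mx_lt _ _ m0); rewrite !lt_min => -[/andP[yr _] /andP[_ yq]].
rewrite /tensor !col_mxKu !col_mxKd.
by apply: ler_pM; [exact: ltW|exact: ltW|exact: fr|exact: fq].
Qed.

Lemma dot_col_mx d1 d2 (u u' : 'cV[R]_d1) (v v' : 'cV[R]_d2) :
  dot (col_mx u v) (col_mx u' v') = dot u u' + dot v v'.
Proof. by rewrite -!dotE tr_col_mx mul_row_col mxE. Qed.

Lemma bump_block d1 d2 (A : 'M[R]_d1) (B : 'M[R]_d2) m1 m2 x :
  bump (block_mx A 0 0 B) (col_mx m1 m2) x =
  bump A m1 (usubmx x) * bump B m2 (dsubmx x).
Proof.
rewrite /bump -expRD -mulrDr -[x in LHS]vsubmxK opp_col_mx add_col_mx.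
by rewrite mul_block_col !mul0mx add0r addr0 dot_col_mx.
Qed.

Lemma tensor_gsum (I1 I2 : finType) d1 d2 c1 c2 mu1 mu2
    (S1 : I1 -> 'M[R]_d1) (S2 : I2 -> 'M[R]_d2) :
  (forall i, pos_def (S1 i)) -> (forall i, pos_def (S2 i)) ->
  tensor (gsum c1 mu1 (fun i => invmx (S1 i)))
         (gsum c2 mu2 (fun i => invmx (S2 i))) =
  gsum (fun p : I1 * I2 => c1 p.1 * c2 p.2)
       (fun p => col_mx (mu1 p.1) (mu2 p.2))
       (fun p => invmx (block_mx (S1 p.1) 0 0 (S2 p.2))).
Proof.
move=> pS1 pS2; apply/funext => x; rewrite /tensor /gsum big_distrlr /=.
rewrite pair_big /=; apply: eq_bigr => -[i j] _ /=.
rewrite /gterm invmx_block_diag; last first.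
  by rewrite block_diag_mx_unit !pos_def_unit.
by rewrite bump_block mulrACA.
Qed.

Lemma realizable_product hom d1 d2 k1 k2 M1 M2 :
  realizable R hom d1 k1 M1 -> realizable R hom d2 k2 M2 ->
  realizable R hom (d1 + d2) (k1 * k2) (M1 * M2).
Proof.
move=> r1 r2; have [i1 _] := realizable_inhabited r1.
have [i2 _] := realizable_inhabited r2.
have [G1 [h1 fin1 [s1 [us1 <- s1M]]]] := r1.
have [G2 [h2 fin2 [s2 [us2 <- s2M]]]] := r2.
have pS1 i : pos_def (cov G1 i) := cov_pos_def G1 i.
have pS2 i : pos_def (cov G2 i) := cov_pos_def G2 i.
have p1 x : 0 < density G1 x.
  by rewrite density_gsum; apply: gsum_gt0 (coef_gt0 G1) i1 x.
have p2 x : 0 < density G2 x.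
  by rewrite density_gsum; apply: gsum_gt0 (coef_gt0 G2) i2 x.
pose c1 i := weight G1 i * gauss_cst (cov G1 i).
pose c2 i := weight G2 i * gauss_cst (cov G2 i).
have tE := tensor_gsum c1 c2 (mean G1) (mean G2) pS1 pS2.
rewrite -!density_gsum in tE.
pose s := [seq col_mx u v | u <- s1, v <- s2].
have <- : size s = (size s1 * size s2)%N by rewrite size_allpairs.
have <- : #|{: 'I_k1 * 'I_k2}| = (k1 * k2)%N by rewrite card_prod !card_ord.
apply: (@realizable_gsum _ hom ('I_k1 * 'I_k2)%type _
  (fun p => c1 p.1 * c2 p.2) (fun p => col_mx (mean G1 p.1) (mean G2 p.2))
  (fun p => block_mx (cov G1 p.1) 0 0 (cov G2 p.2)) s (i1, i2)).
- by move=> p; rewrite mulr_gt0 // coef_gt0.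
- by move=> p; apply: pos_def_block; [exact: pS1|exact: pS2].
- by move=> h p q; rewrite (h1 h p.1 q.1) (h2 h p.2 q.2).
- rewrite -tE.
  apply: (@sub_finite_set _ _
    [set col_mx u v | u in Mode (density G1) & v in Mode (density G2)]).
    move=> x; rewrite -(vsubmxK x) => /(Mode_tensor _ _ p1 p2)[mu mv].
    by exists (usubmx x) => //; exists (dsubmx x).
  exact: finite_image2.
- apply: allpairs_uniq => // -[u v] [u' v'] _ _ /= /eq_col_mx[-> ->].
  by [].
move=> x /allpairsP[[u v] /= [us vs ->]]; rewrite -tE.
by apply/(Mode_tensor _ _ p1 p2); split; [exact: s1M|exact: s2M].
Qed.

Lemma realizable_prod hom t (p : 'I_t -> triple) :
  (forall j, realizable R hom (tdim (p j)) (tcomp (p j)) (tmodes (p j))) ->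
  realizable R hom (\sum_(j < t) tdim (p j)) (\prod_(j < t) tcomp (p j))
    (\prod_(j < t) tmodes (p j)).
Proof.
elim: t p => [|t IH] p pr; first by rewrite !big_ord0; exact: realizable_single.
by rewrite !big_ord_recr /=; apply: realizable_product => //; exact: IH.
Qed.

(** The spare dimensions are filled by a single Gaussian, the spare components
    one at a time. *)
Lemma realizable_choice hom (S : set triple) d k t (p : 'I_t -> triple) :
  (0 < d)%N ->
  (forall q, S q -> realizable R hom (tdim q) (tcomp q) (tmodes q)) ->
  admissible S d k p -> realizable R hom d k (choice_value k p).
Proof.
move=> d0 Sr [pS dsum kprod]; have := realizable_prod (fun j => Sr _ (pS j)).
move=> /realizable_product.
move=> /(_ _ _ _ (realizable_single R hom (d - \sum_(j < t) tdim (p j)))).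
rewrite subnKC // !muln1; case: d d0 {dsum} => // n _.
move=> /(realizable_add_many (k - \prod_(j < t) tcomp (p j))).
by rewrite subnK.
Qed.

Lemma nb_modes_ge d (f : 'cV[R]_d -> R) s : finite_set (Mode f) -> uniq s ->
  (forall x, x \in s -> Mode f x) -> (size s <= nb_modes f)%N.
Proof.
move=> fin us sM; apply: uniq_leq_size => // x /sM xM.
have : x \in fset_set (Mode f) by rewrite in_fset_set // inE.
by [].
Qed.

Lemma seed_realizable (hom : bool) d k M (G : gauss_mixture R d k) :
  (hom -> homoscedastic G) -> finite_set (Mode (density G)) ->
  (M <= nb_modes (density G))%N -> realizable R hom d k M.
Proof.
move=> hG fin MG; exists G; split=> //.
exists (take M (fset_set (Mode (density G)))); split.
- by rewrite take_uniq // fset_uniq.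
- by rewrite size_takel.
by move=> x /mem_take; rewrite in_fset_set // inE.
Qed.

End Product.

(** * The lower bounds *)

Theorem theorem4p10 (R : realType) (S : set triple) (d k : nat)
    (hd : (1 <= d)%N) (hk : (1 <= k)%N) :
  ((forall p : triple, S p -> seed_triple R p) ->
     (seed_bound R S d k <= max_modes R d k)%E) /\
  ((forall p : triple, S p -> hom_seed_triple R p) ->
     (seed_bound R S d k <= max_modes_hom R d k)%E).
Proof.
split=> Sseed; apply: ge_ereal_sup => _ [t [p [adm ->]]].
  have [q Sq|G [_ fin [s [us <- sM]]]] :=
    @realizable_choice R false _ _ _ _ _ hd _ adm.
    have [_ _ _ [G [fin MG]]] := Sseed q Sq.
    exact: seed_realizable fin MG.
  apply: (@le_trans _ _ (nb_modes (density G))%:R%:E).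
    by rewrite lee_fin ler_nat nb_modes_ge.
  by apply: ereal_sup_ubound; exists G.
have [q Sq|G [hG fin [s [us <- sM]]]] :=
  @realizable_choice R true _ _ _ _ _ hd _ adm.
  have [_ _ _ [G [hG fin MG]]] := Sseed q Sq.
  exact: seed_realizable fin MG.
apply: (@le_trans _ _ (nb_modes (density G))%:R%:E).
  by rewrite lee_fin ler_nat nb_modes_ge.
by apply: ereal_sup_ubound; exists G; split=> //; exact: hG.
Qed.
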